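(* Let $d$ be a positive integer and $G$ a graph. If $G$ is $d(d+1)^2$-connected, or $\mathcal{R}_d(G)$ is vertically $(d(d+1))^2$-connected, then $G$ is $\mathcal{R}_d$-reconstructible.
   Context: Graphs are finite, simple, without isolated vertices. For a graph $G$ and $p:V(G)\to\mathbb{R}^d$, the rigidity matrix $R(G,p)$ has a row for each edge and $d$ columns per vertex; the row of $uv$ has $p(u)-p(v)$ in the columns of $u$, $p(v)-p(u)$ in the columns of $v$, and zeros elsewhere. $\mathcal{R}_d(G)$ is the row matroid of $R(G,p)$ for a generic $p$. For a matroid with rank function $r$ on ground set $E$ and a positive integer $k$, a bipartition $(E_1,E_2)$ of $E$ is a vertical $k$-separation if $r(E_1),r(E_2)\ge k$ and $r(E_1)+r(E_2)\le r(E)+k-1$; the matroid is vertically $k$-connected if its rank is at least $k$ and it has no vertical $k'$-separation for any positive integer $k'<k$. $G$ is $\mathcal{R}_d$-reconstructible if for every graph $H$ and every matroid isomorphism $\psi:E(G)\to E(H)$ between $\mathcal{R}_d(G)$ and $\mathcal{R}_d(H)$ there is a graph isomorphism $\varphi:V(G)\to V(H)$ with $\psi(uv)=\varphi(u)\varphi(v)$ for all $uv\in E(G)$. *)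

(* Defs.v *)
From mathcomp Require Import all_boot all_order all_algebra.
From mathcomp Require Import mpoly.
From mathcomp Require Import reals.

Set Implicit Arguments.
Unset Strict Implicit.
Unset Printing Implicit Defensive.
Import Order.TTheory GRing.Theory Num.Theory.
Local Open Scope ring_scope.

Definition is_graph (T : finType) (e : rel T) : Prop :=
  [/\ ssrbool.symmetric e, irreflexive e & forall v : T, exists u : T, e v u].

Definition edges (T : finType) (e : rel T) : {set {set T}} :=
  [set [set x.1; x.2] | x in [pred x : T * T | e x.1 x.2]].

Definition k_connected (T : finType) (e : rel T) (k : nat) : Prop :=
  (k < #|T|)%N /\
  forall S : {set T}, (#|S| < k)%N ->
    forall u v : T, u \notin S -> v \notin S ->
      connect [rel x y | [&& e x y, x \notin S & y \notin S]] u v.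

(* Rigidity matrix.  A configuration p : V(G) -> R^d is a function
   T -> 'rV[R]_d.  Columns of R(G,p) are indexed by T * 'I_d
   (d columns per vertex).  The row of the edge s = {u,v} has
   p(u) - p(v) in the columns of u, p(v) - p(u) in the columns of v,
   and zeros elsewhere. *)
Section Rigidity.
Variables (R : realType) (d : nat) (T : finType).

Definition ncols := #|{: T * 'I_d}|.

Definition rig_row (p : T -> 'rV[R]_d) (s : {set T}) : 'rV[R]_ncols :=
  \row_(j < ncols)
    let wk := enum_val j in
    if wk.1 \in s then \sum_(x in s | x != wk.1) (p wk.1 0 wk.2 - p x 0 wk.2)
    else 0.

Definition rig_mx (p : T -> 'rV[R]_d) (F : {set {set T}}) : 'M[R]_(#|F|, ncols) :=
  \matrix_(i < #|F|) rig_row p (enum_val i).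

Definition rig_rank (p : T -> 'rV[R]_d) (F : {set {set T}}) : nat :=
  \rank (rig_mx p F).

Definition generic (p : T -> 'rV[R]_d) : Prop :=
  forall q : mpoly.mpoly ncols rat, q != 0 ->
    mpoly.mmap (ratr : rat -> R) (fun j : 'I_ncols => p (enum_val j).1 0 (enum_val j).2) q != 0.
End Rigidity.

Definition vert_sep (A : finType) (r : {set A} -> nat) (E : {set A}) (k : nat)
    (E1 E2 : {set A}) : Prop :=
  [/\ E1 :|: E2 = E, [disjoint E1 & E2],
      (k <= r E1)%N, (k <= r E2)%N & (r E1 + r E2 <= r E + k - 1)%N].

Definition vert_connected (A : finType) (r : {set A} -> nat) (E : {set A})
    (k : nat) : Prop :=
  (k <= r E)%N /\
  forall k' : nat, (0 < k')%N -> (k' < k)%N ->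
    ~ exists E1 E2 : {set A}, vert_sep r E k' E1 E2.

(* R_d(G) is vertically k-connected (R_d(G) = row matroid of R(G,p),
   p generic; the condition is imposed for every generic p). *)
Definition Rd_vert_connected (R : realType) (d : nat) (T : finType) (e : rel T)
    (k : nat) : Prop :=
  forall p : T -> 'rV[R]_d, generic p ->
    vert_connected (rig_rank p) (edges e) k.

Definition Rd_iso (R : realType) (d : nat) (T T' : finType) (e : rel T) (e' : rel T')
    (psi : {set T} -> {set T'}) : Prop :=
  [/\ {in edges e &, injective psi}, psi @: edges e = edges e' &
      forall (p : T -> 'rV[R]_d) (q : T' -> 'rV[R]_d), generic p -> generic q ->
        forall F : {set {set T}}, F \subset edges e ->
          rig_rank q (psi @: F) = rig_rank p F].

Definition Rd_reconstructible (R : realType) (d : nat) (T : finType) (e : rel T) : Prop :=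
  forall (T' : finType) (e' : rel T'), is_graph e' ->
  forall psi : {set T} -> {set T'}, Rd_iso R d e e' psi ->
    exists phi : T -> T',
      [/\ bijective phi, forall u v : T, e' (phi u) (phi v) = e u v &
          forall u v : T, e u v -> psi [set u; v] = [set phi u; phi v]].

(* Main.v *)
(** Rigidity: a d(d+1)-connected graph is rigid. Pass to its closure, in which two
cliques sharing d vertices span a clique. A vertex whose neighbourhood is a
clique can be deleted. If there is none, insert the vertices in random order: a
vertex with j earlier neighbours raises the rank by at least min(d, j), and by
one more when j > d and these neighbours do not form a clique (a 1-extension).
Each vertex then gains at least d on average, so the rank is at least d|V|, which
is impossible. The averaging is carried out without probability, by a closed
formula for a lower bound of the expected gain.

Splits: the excess of a bipartition of the edge set E into E1 and E2 is
r(E1)+r(E2)-r(E). In a (d(d+1)+t+1)-connected graph every bipartition of excess at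
most t has a spanning side. Deleting a vertex that meets both sides lowers the
excess, and a side that spans the smaller graph also spans the whole graph unless
that vertex has so many edges on the other side that the excess is larger than t.

Transfer: the conclusion of the previous step is a matroid property, and in a graph
without isolated vertices it excludes small separators, because the row spaces of
the two sides of a separator S meet in dimension at most d(|S|-1). Hence every graph
H with the rigidity matroid of a highly connected graph G is rigid, and so is the
image of every G-v. Comparing ranks, this image misses exactly one vertex of H and
is induced, so that stars are mapped to stars. *)

Require Import Defs.
From mathcomp Require Import all_boot all_order all_algebra.
From mathcomp Require Import reals zify ring lra.
From mathcomp Require classical_sets cardinality lebesgue_measure mpoly.

Set Implicit Arguments.
Unset Strict Implicit.
Unset Printing Implicit Defensive.
Import Order.TTheory GRing.Theory Num.Theory.
Local Open Scope ring_scope.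

(** * Existence of generic configurations *)

Section AvoidRoots.
Import classical_sets cardinality measure lebesgue_measure constructive_ereal.
Local Open Scope classical_set_scope.

(** Otherwise the reals would be a countable union of finite root sets, hence countable, whereas the
    interval from 0 to 1 has Lebesgue measure 1. *)
Lemma countable_poly_avoid (R : realType) (I : countType) (f : I -> {poly R}) :
  (forall i, f i != 0) -> exists x, forall i, ~~ root (f i) x.
Proof.
move=> f0; apply: boolp.contrapT => noX.
have cR : countable [set: R].
  have -> : [set: R] = \bigcup_(i in [set: I]) [set x | root (f i) x].
    apply/seteqP; split=> // x _; apply: boolp.contrapT => nx; apply: noX.
    exists x => i; apply/negP => rx; apply: nx.
    by exists i.
  apply: bigcup_countable => // i _; apply: finite_set_countable.
  (* An infinite root set would contain [size (f i)] distinct roots, one more than the degree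
     allows. *)
  apply: boolp.contrapT => /(@infinite_set_fset _ _ (size (f i))) [A sA cA].
  have := @max_poly_roots R (f i) (finmap.enum_fset A) (f0 i).
  rewrite ltnNge cA => /(_ _ _)/negP; apply=> //.
    by apply/allP => x xA; exact: (sA x xA).
  exact: finmap.fset_uniq.
have c01 : countable [set` Interval (BLeft (0 : R)) (BRight 1)].
  by apply: sub_countable cR; apply: subset_card_le.
have := countable_lebesgue_measure0 c01; rewrite lebesgue_measure_itv /=.
by rewrite lte_fin ltr01 sube0 => /eqP; rewrite eqe oner_eq0.
Qed.
End AvoidRoots.

Section AlgebraicIndependence.
Import mpoly.

Lemma muni_eq0 n (q : {mpoly rat[n.+1]}) : muni q = 0 -> q = 0.
Proof.
move=> q0; apply/mpolyP => m; rewrite mcoeff0.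
pose res (m : 'X_{1..n.+1}) := [multinom (m (widen_ord (leqnSn n) i)) | i < n].
have res_inj m1 m2 : res m1 = res m2 -> m1 ord_max = m2 ord_max -> m1 = m2.
  move=> /mnmP e1 e2; apply/mnmP => i.
  case: (unliftP ord_max i) => [j ->|->] //.
  have := e1 j; rewrite !mnmE.
  suff -> : widen_ord (leqnSn n) j = lift ord_max j by [].
  by apply: val_inj; rewrite /= /bump leqNgt ltn_ord.
have /(congr1 (fun r : {poly {mpoly rat[n]}} => r`_(m ord_max)@_(res m))) := q0.
rewrite coef0 mcoeff0 muniE coef_sum linear_sum /=.
have [mq|/memN_msupp_eq0 //] := boolP (m \in msupp q).
rewrite (bigD1_seq m) ?msupp_uniq //= coefZ coefXn eqxx mulr1.
rewrite mcoeffZ mcoeffX eqxx mulr1.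
rewrite big1 ?addr0 // => m' nm; rewrite coefZ coefXn.
case: eqP => [e|_]; last by rewrite mulr0 mcoeff0.
rewrite mulr1 mcoeffZ mcoeffX; case: eqP => [e'|]; last by rewrite mulr0.
by rewrite (res_inj _ _ e' (esym e)) eqxx in nm.
Qed.

Lemma mmap_muni (R : realType) n (h : 'I_n -> R) (x : R) (h' : 'I_n.+1 -> R)
    (q : {mpoly rat[n.+1]}) :
  (forall i, h' (widen_ord (leqnSn n) i) = h i) -> h' ord_max = x ->
  mmap ratr h' q = (map_poly (mmap ratr h) (muni q)).[x].
Proof.
move=> hw hx; rewrite muniE raddf_sum -horner_evalE raddf_sum /=.
apply: eq_bigr => m _; rewrite horner_evalE.
rewrite map_polyZ hornerZ map_polyXn hornerXn.
rewrite /= mmapZ mmapX /mmap1 big_ord_recr /= hx mulrA; congr (_ * _ * _).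
by apply: eq_bigr => i _; rewrite hw mnmE.
Qed.

(** Induction on [n]: the last coordinate avoids the roots of the countably many nonzero univariate
    polynomials obtained by evaluating the first [n] variables at [h]. *)
Lemma exists_alg_indep (R : realType) n : exists h : 'I_n -> R,
  forall q : {mpoly rat[n]}, q != 0 -> mmap (ratr : rat -> R) h q != 0.
Proof.
elim: n => [|n [h hP]].
  exists (fun=> 0) => q; rewrite (nvar0_mpolyC q) mmapC; apply: contra.
  by rewrite /= fmorph_eq0 => /eqP ->.
(* Polynomials are indexed by lists of monomials with coefficients, which form a countable type;
   zero polynomials are replaced by 1 below. *)
pose Q (s : seq ('X_{1..n.+1} * rat)) :=
  map_poly (mmap (ratr : rat -> R) h) (muni (\sum_(c <- s) c.2 *: 'X_[c.1])).
have [|x xP] := @countable_poly_avoid R _ (fun s => if Q s == 0 then 1 else Q s).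
  by move=> s; case: ifP => [_|/negbT //]; exact: oner_neq0.
exists (fun i => oapp h x (unlift ord_max i)) => q q0.
rewrite (@mmap_muni _ _ h x); first last.
- by rewrite unlift_none.
- move=> i; have -> : widen_ord (leqnSn n) i = lift ord_max i.
    by apply: val_inj; rewrite /= /bump leqNgt ltn_ord.
  by rewrite liftK.
have := xP [seq (m, q@_m) | m <- msupp q].
rewrite /Q big_map /= -mpolyE ifF //.
(* If the specialised polynomial vanishes, so do the values at [h] of all coefficients of [muni q],
   and independence of [h] makes these coefficients zero. *)
apply: contraNF q0 => /eqP /polyP e; apply/eqP/muni_eq0/polyP => i.
rewrite coef0; apply/eqP; apply/negPn/negP => /hP/eqP; apply.
by have := e i; rewrite coef0 coef_map.
Qed.
End AlgebraicIndependence.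

(** The matroid hypotheses quantify over all generic configurations; existence is what gives them
    content. *)
Lemma exists_generic (R : realType) d (T : finType) :
  exists p : T -> 'rV[R]_d, generic p.
Proof.
have [h hP] := exists_alg_indep R (ncols d T).
exists (fun v => \row_k h (enum_rank (v, k))) => q /hP.
suff -> : (fun j => (\row_k h (enum_rank ((enum_val j).1, k)))
                      0 (enum_val j).2) = h by [].
apply: boolp.funext => j; rewrite mxE; congr h.
by rewrite -surjective_pairing enum_valK.
Qed.

(** * Generic position *)

Section Specialization.
Import mpoly.
Variables (R : realType) (d : nat) (T : finType).
Implicit Types p q : T -> 'rV[R]_d.

Local Notation config_eval p :=
  (mmap ratr (fun j : 'I_(ncols d T) => p (enum_val j).1 0 (enum_val j).2)).

Definition coordX (v : T) (k : 'I_d) : {mpoly rat[ncols d T]} :=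
  'X_(enum_rank (v, k)).

Lemma config_evalX p v k : config_eval p (coordX v k) = p v 0 k.
Proof. by rewrite mmapX mmap1U enum_rankK. Qed.

(** A minor that is nonzero at [q] is a nonzero polynomial with rational coefficients, so it is
    nonzero at the generic [p] too. *)
Lemma generic_rank_ge p q m n (P : 'M[{mpoly rat[ncols d T]}]_(m, n)) :
  generic p ->
  (\rank (map_mx (config_eval q) P) <= \rank (map_mx (config_eval p) P))%N.
Proof.
move=> gp; set A := map_mx _ P; set B := map_mx _ P.
pose f := maxrankfun A.
have rf : row_full (rowsub f A)^T.
  by rewrite /row_full mxrank_tr eq_maxrowsub.
pose g := fullrankfun rf.
pose M := mxsub f g P.
have : \det (map_mx (config_eval q) M) != 0.
  rewrite -unitfE -unitmxE -unitmx_tr.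
  have := fullrowsub_unit rf.
  suff -> : rowsub (fullrankfun rf) (rowsub f A)^T = (map_mx (config_eval q) M)^T.
    by [].
  by apply/matrixP => i j; rewrite !mxE.
rewrite det_map_mx => dM.
have : \det (map_mx (config_eval p) M) != 0.
  rewrite det_map_mx; apply: gp; apply: contra dM => /eqP ->.
  by rewrite rmorph0.
rewrite -unitfE -unitmxE -row_free_unit /row_free => /eqP e.
rewrite -[X in (X <= _)%N]e.
have -> : map_mx (config_eval p) M = rowsub f 1%:M *m (B *m colsub g 1%:M).
  rewrite -rowsubE mulmx_colsub mulmx1 -mxsubrc.
  by apply/matrixP => i j; rewrite !mxE.
exact: leq_trans (mxrankM_maxr _ _) (mxrankM_maxl _ _).
Qed.

Lemma generic_rig_rank_ge p q (F : {set {set T}}) : generic p ->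
  (rig_rank q F <= rig_rank p F)%N.
Proof.
move=> gp.
pose P : 'M[{mpoly rat[ncols d T]}]_(#|F|, ncols d T) := \matrix_(i, j)
  let wk : T * 'I_d := enum_val j in let s : {set T} := enum_val i in
  if wk.1 \in s then \sum_(x in s | x != wk.1) (coordX wk.1 wk.2 - coordX x wk.2)
  else 0.
have PE (r : T -> 'rV[R]_d) : map_mx (config_eval r) P = rig_mx r F.
  apply/matrixP => i j; rewrite !mxE /=.
  case: ifP => _; last by rewrite rmorph0.
  rewrite rmorph_sum; apply: eq_bigr => x _.
  by rewrite rmorphB /= !config_evalX.
by rewrite /rig_rank -!PE; apply: generic_rank_ge.
Qed.

(** By [generic_rank_ge] it suffices to find one affinely independent placement of [Z], and the
    vertices of a simplex provide it. *)
Lemma generic_affine_indep p (Z : {set T}) (c : T -> R) : generic p ->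
  (#|Z| <= d.+1)%N -> \sum_(z in Z) c z *: p z = 0 -> \sum_(z in Z) c z = 0 ->
  forall z, z \in Z -> c z = 0.
Proof.
move=> gp Zd cp c0.
pose P : 'M[{mpoly rat[ncols d T]}]_(#|Z|, d + 1) :=
  row_mx (\matrix_(i, k) coordX (enum_val i) k) (const_mx 1).
have PE (r : T -> 'rV[R]_d) : map_mx (config_eval r) P =
    row_mx (\matrix_(i < #|Z|) r (enum_val i)) (const_mx 1).
  rewrite map_row_mx; congr row_mx; apply/matrixP => i j; rewrite !mxE.
    by rewrite config_evalX.
  by rewrite rmorph1.
(* The first [d] points go to the unit vectors, a point of index [d] to the origin; for the latter
   only the column of ones is left to kill its coefficient. *)
pose q (z : T) : 'rV[R]_d := \row_k (index z (enum Z) == k)%:R.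
have rq : row_free (map_mx (config_eval q) P).
  rewrite -kermx_eq0; apply/eqP/row_matrixP => i; rewrite row0.
  have /sub_kermxP := row_sub i (kermx (map_mx (config_eval q) P)).
  move: (row i _) => u; rewrite PE mul_mx_row -row_mx0 => /eq_row_mx [uq u1].
  have uj (j : 'I_#|Z|) : (j < d)%N -> u 0 j = 0.
    move=> jd; have /rowP/(_ (Ordinal jd)) := uq.
    rewrite !mxE (bigD1 j) //= !mxE index_uniq -?cardE ?enum_uniq // eqxx mulr1.
    rewrite big1 ?addr0 // => k kj; rewrite !mxE /enum_val.
    rewrite index_uniq -?cardE ?enum_uniq //=.
    by move: kj; rewrite -val_eqE /= => /negPf ->; rewrite mulr0.
  apply/rowP => j; rewrite mxE; case: (ltnP j d) => [/uj //|dj].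
  have /rowP/(_ 0) := u1; rewrite !mxE (bigD1 j) //= mxE mulr1.
  rewrite big1 ?addr0 // => k kj; rewrite uj ?mul0r //.
  rewrite ltn_neqAle -ltnS (leq_trans (ltn_ord k) Zd) andbT.
  have : (j < d.+1)%N by apply: leq_trans (ltn_ord j) Zd.
  rewrite ltnS => jd; have jE : j = d :> nat by apply/eqP; rewrite eqn_leq jd dj.
  by rewrite -jE.
have : row_free (map_mx (config_eval p) P).
  rewrite /row_free eqn_leq rank_leq_row /=.
  by apply: leq_trans (generic_rank_ge q P gp); rewrite (eqP rq).
move=> /row_freeP [B PB] z zZ.
pose u : 'rV[R]_#|Z| := \row_i c (enum_val i).
have : u *m map_mx (config_eval p) P = 0.
  rewrite PE mul_mx_row -row_mx0; congr row_mx.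
    rewrite mulmx_sum_row -[RHS]cp (big_enum_val (fun z => c z *: p z)) /=.
    by apply: eq_bigr => i _; rewrite rowK mxE.
  apply/rowP => k; rewrite !mxE -[RHS]c0 (big_enum_val c) /=.
  by apply: eq_bigr => i _; rewrite !mxE mulr1.
move=> /(congr1 (mulmx^~ B)); rewrite -mulmxA PB mulmx1 mul0mx.
by move=> /rowP /(_ (enum_rank_in zZ z)); rewrite !mxE enum_rankK_in.
Qed.

End Specialization.

(** * Row spaces and extensions *)

Definition all_edges (T : finType) (U : {set T}) : {set {set T}} :=
  [set s : {set T} | (s \subset U) & #|s| == 2].

Definition star (T : finType) (x : T) (Z : {set T}) : {set {set T}} :=
  [set [set x; z] | z in Z].

Lemma mem_star (T : finType) (x z : T) (Z : {set T}) :
  z \in Z -> [set x; z] \in star x Z.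
Proof. by move=> zZ; apply: imset_f. Qed.

Lemma subset_of_card (T : finType) (Z : {set T}) n : (n <= #|Z|)%N ->
  exists2 Y : {set T}, Y \subset Z & #|Y| = n.
Proof.
move=> /card_geqP [s [us <- sZ]]; exists [set x in s].
  by apply/subsetP => x; rewrite inE => /sZ.
by rewrite cardsE; apply/card_uniqP.
Qed.

Section Span.
Variables (R : realType) (d : nat) (T : finType).
Implicit Types (p q : T -> 'rV[R]_d) (F : {set {set T}}) (s U Z : {set T}).

(** Written as a sum over [F], the row space can be handled without enumerating [F]. *)
Definition rig_span p F : 'M[R]_(ncols d T) := (\sum_(s in F) <<rig_row p s>>)%MS.

Lemma rig_rankE p F : rig_rank p F = \rank (rig_span p F).
Proof.
apply: eqmx_rank; apply/andP; split.
  apply/row_subP => i; rewrite rowK (sumsmx_sup (enum_val i)) ?genmxE //.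
  exact: enum_valP.
apply/sumsmx_subP => s sF; rewrite genmxE.
by rewrite (eq_row_sub (enum_rank_in sF s)) // rowK enum_rankK_in.
Qed.

Lemma rig_row_span p F s : s \in F -> (rig_row p s <= rig_span p F)%MS.
Proof. by move=> sF; rewrite (sumsmx_sup s) ?genmxE. Qed.

Lemma rig_span_subP p F m (A : 'M_(m, _)) :
  (forall s, s \in F -> (rig_row p s <= A)%MS) -> (rig_span p F <= A)%MS.
Proof. by move=> H; apply/sumsmx_subP => s sF; rewrite genmxE H. Qed.

Lemma rig_spanS p F1 F2 : F1 \subset F2 -> (rig_span p F1 <= rig_span p F2)%MS.
Proof. by move=> /subsetP H; apply: rig_span_subP => s /H /rig_row_span. Qed.

Lemma rig_spanU p F1 F2 :
  (rig_span p (F1 :|: F2) :=: rig_span p F1 + rig_span p F2)%MS.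
Proof.
apply/eqmxP; rewrite addsmx_sub !rig_spanS ?subsetUl ?subsetUr // !andbT.
apply: rig_span_subP => s; rewrite inE => /orP [] /(rig_row_span p) H.
  exact: submx_trans H (addsmxSl _ _).
exact: submx_trans H (addsmxSr _ _).
Qed.

Lemma rig_rankS p F1 F2 : F1 \subset F2 -> (rig_rank p F1 <= rig_rank p F2)%N.
Proof. by move=> H; rewrite !rig_rankE mxrankS ?rig_spanS. Qed.

Lemma rig_rankU p F1 F2 :
  (rig_rank p (F1 :|: F2) <= rig_rank p F1 + rig_rank p F2)%N.
Proof. by rewrite !rig_rankE rig_spanU mxrank_adds_leqif. Qed.

Lemma rig_rank_card p F : (rig_rank p F <= #|F|)%N.
Proof. exact: rank_leq_row. Qed.

Lemma rig_span_rank p F1 F2 : F1 \subset F2 ->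
  (rig_rank p F2 <= rig_rank p F1)%N -> (rig_span p F2 <= rig_span p F1)%MS.
Proof.
move=> sF; rewrite !rig_rankE => rF.
by rewrite -(geq_leqif (mxrank_leqif_sup (rig_spanS p sF))).
Qed.

Lemma rig_rank_span p F1 F2 :
  (rig_span p F2 <= rig_span p F1)%MS -> (rig_rank p F2 <= rig_rank p F1)%N.
Proof. by move=> sF; rewrite !rig_rankE mxrankS. Qed.

Lemma rig_rankU1 p F s : ~~ (rig_row p s <= rig_span p F)%MS ->
  (rig_rank p F < rig_rank p (s |: F))%N.
Proof.
rewrite ltnNge; apply: contra => /(rig_span_rank (subsetUr _ _)).
by apply: submx_trans; apply: rig_row_span; rewrite !inE eqxx.
Qed.

Lemma rig_spanP p F (u : 'rV[R]_(ncols d T)) : (u <= rig_span p F)%MS ->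
  exists c : {set T} -> R, u = \sum_(s in F) c s *: rig_row p s.
Proof.
move=> /sub_sumsmxP [w ->].
have H s : exists c, w s *m <<rig_row p s>>%MS = c *: rig_row p s.
  by apply/sub_rVP; rewrite (submx_trans (submxMl _ _)) ?genmxE.
have [c cP] := fin_all_exists H.
by exists c; apply: eq_bigr.
Qed.

Definition at_vertex (w : T) (u : 'rV[R]_(ncols d T)) : 'rV[R]_d :=
  \row_k u 0 (enum_rank (w, k)).

Lemma at_vertexP (u v : 'rV[R]_(ncols d T)) :
  (forall w, at_vertex w u = at_vertex w v) -> u = v.
Proof.
move=> H; apply/rowP => j; have /rowP/(_ (enum_val j).2) := H (enum_val j).1.
by rewrite !mxE -surjective_pairing enum_valK.
Qed.

Lemma at_vertex_sum w (I : Type) (r : seq I) (P : pred I) (c : I -> R)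
    (f : I -> 'rV[R]_(ncols d T)) :
  at_vertex w (\sum_(i <- r | P i) c i *: f i) =
  \sum_(i <- r | P i) c i *: at_vertex w (f i).
Proof.
apply/rowP => k; rewrite mxE !summxE.
by apply: eq_bigr => i _; rewrite !mxE.
Qed.

Lemma at_vertexD w u v : at_vertex w (u + v) = at_vertex w u + at_vertex w v.
Proof. by apply/rowP => k; rewrite !mxE. Qed.

Lemma at_vertex0 w : at_vertex w 0 = 0.
Proof. by apply/rowP => k; rewrite !mxE. Qed.

Lemma at_rig_row_out p s w : w \notin s -> at_vertex w (rig_row p s) = 0.
Proof.
by move=> /negPf ws; apply/rowP => k; rewrite !mxE enum_rankK /= ws.
Qed.

Lemma at_rig_rowl p x y : x != y -> at_vertex x (rig_row p [set x; y]) = p x - p y.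
Proof.
move=> xy; apply/rowP => k; rewrite !mxE enum_rankK /= set21.
rewrite (big_pred1 y) ?mxE // => z /=; rewrite !inE.
by case: (eqVneq z y) => [->|]; rewrite ?orbT ?orbF 1?eq_sym //= andbN.
Qed.

Lemma at_rig_rowr p x y : x != y -> at_vertex y (rig_row p [set x; y]) = p y - p x.
Proof. by move=> xy; rewrite setUC at_rig_rowl // eq_sym. Qed.

Lemma at_span_out p F w u : (forall s, s \in F -> w \notin s) ->
  (u <= rig_span p F)%MS -> at_vertex w u = 0.
Proof.
move=> wF /rig_spanP [c ->]; rewrite at_vertex_sum big1 // => s sF.
by rewrite at_rig_row_out ?scaler0 ?wF.
Qed.

Lemma rig_row_ext p q s : {in s, p =1 q} -> rig_row p s = rig_row q s.
Proof.
move=> pq; apply/rowP => j; rewrite !mxE /=; case: ifP => // js.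
by apply: eq_bigr => x /andP [xs _]; rewrite !pq.
Qed.

Lemma star_inj x Z : x \notin Z -> {in Z &, injective (fun z => [set x; z])}.
Proof.
move=> xZ y z yZ zZ /setP /(_ y); rewrite !inE eqxx orbT => /esym/orP [] /eqP //.
by move=> yx; rewrite yx (negPf xZ) in yZ.
Qed.

(** In the columns of [x] the rows of [F] vanish and those of the star are the directions
    [q x - q z]. The configuration need not be generic, so that [one_extension] can use a special
    position. *)
Lemma zero_extension_indep q F x Z :
  (forall s, s \in F -> x \notin s) -> x \notin Z ->
  (forall c : T -> R, \sum_(z in Z) c z *: (q x - q z) = 0 ->
     forall z, z \in Z -> c z = 0) ->
  (rig_rank q F + #|Z| <= rig_rank q (F :|: star x Z))%N.
Proof.
move=> xF; have [n] := ubnP #|Z|; elim: n Z => // n IH Z Zn xZ Zi.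
have [->|[z zZ]] := set_0Vmem Z.
  by rewrite cards0 addn0 rig_rankS ?subsetUl.
have Z'n : (#|Z :\ z| < n)%N by move: Zn; rewrite (cardsD1 z) zZ.
have xZ' : x \notin Z :\ z by rewrite !inE negb_and xZ orbT.
have Z'i (c : T -> R) : \sum_(y in Z :\ z) c y *: (q x - q y) = 0 ->
    forall y, y \in Z :\ z -> c y = 0.
  move=> c0 y; rewrite !inE => /andP [yz yZ].
  have := Zi (fun y => if y == z then 0 else c y) _ y yZ.
  rewrite (negPf yz); apply; rewrite (big_setD1 z) //= eqxx scale0r add0r -[RHS]c0.
  by apply: eq_bigr => t; rewrite !inE => /andP [/negPf -> _].
have := IH _ Z'n xZ' Z'i; rewrite [in X in _ -> X](cardsD1 z) zZ add1n addnS.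
move=> H; apply: (leq_ltn_trans H).
have -> : F :|: star x Z = [set x; z] |: (F :|: star x (Z :\ z)).
  by rewrite /star -{1}(setD1K zZ) imsetU1 setUCA.
apply: rig_rankU1; apply/negP; rewrite rig_spanU.
move=> /sub_addsmxP [[u v] /= e].
have [c cE] : exists c, v *m rig_span q (star x (Z :\ z)) =
    \sum_(s in star x (Z :\ z)) c s *: rig_row q s.
  by apply: rig_spanP; rewrite submxMl.
have xz : x != z by apply: contraNneq xZ => ->.
have /(congr1 (at_vertex x)) := e.
rewrite at_rig_rowl // at_vertexD (@at_span_out q F) ?submxMl // add0r cE.
rewrite at_vertex_sum big_imset /=; last exact: star_inj.
(* With coefficient -1 at [z], the relation becomes a nontrivial dependency among the directions. *)
move=> e'; pose c' y := if y == z then -1 else c [set x; y].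
have : c' z = 0; last first.
  by rewrite /c' eqxx => /eqP; rewrite oppr_eq0 oner_eq0.
apply: Zi => //; rewrite (big_setD1 z) //= /c' eqxx scaleN1r e'.
apply/eqP; rewrite addrC subr_eq0; apply/eqP/eq_bigr => y.
rewrite !inE => /andP [/negPf -> yZ]; rewrite at_rig_rowl //.
by apply: contraNneq xZ => ->.
Qed.

End Span.

Section Generic.
Variables (R : realType) (d : nat) (T : finType) (p : T -> 'rV[R]_d).
Hypothesis gp : generic p.
Implicit Types (F : {set {set T}}) (s U Z : {set T}).

Lemma zero_extension F x Z : (forall s, s \in F -> x \notin s) -> x \notin Z ->
  (#|Z| <= d)%N -> (rig_rank p F + #|Z| <= rig_rank p (F :|: star x Z))%N.
Proof.
move=> xF xZ Zd; apply: zero_extension_indep => // c c0 z zZ.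
(* A linear relation among the [p x - p z], read as an affine relation among the at most d+1 points
   of [x |: Z]. *)
pose l y := if y == x then \sum_(z in Z) c z else - c y.
have zx y : y \in Z -> (y == x) = false.
  by move=> yZ; apply: contraNF xZ => /eqP <-.
have : l z = 0; last by rewrite /l zx // => /eqP; rewrite oppr_eq0 => /eqP.
apply: (generic_affine_indep gp (Z := x |: Z)).
- by rewrite cardsU1 xZ.
- rewrite big_setU1 //= /l eqxx scaler_suml -[RHS]c0 -big_split /=.
  by apply: eq_bigr => y yZ; rewrite zx // scalerBr scaleNr.
- rewrite big_setU1 //= /l eqxx -big_split /= big1 // => y yZ.
  by rewrite zx // subrr.
- by rewrite inE zZ orbT.
Qed.

Lemma zero_extension_min F x Z : (forall s, s \in F -> x \notin s) -> x \notin Z ->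
  (rig_rank p F + minn d #|Z| <= rig_rank p (F :|: star x Z))%N.
Proof.
move=> xF xZ; have [Y YZ Yd] := subset_of_card (geq_minr d #|Z|).
have xY : x \notin Y by apply: contra xZ; apply: subsetP.
rewrite -Yd; apply: leq_trans (zero_extension xF xY _) _.
  by rewrite Yd geq_minl.
by apply: rig_rankS; rewrite setUS ?imsetS.
Qed.

(** The leaves are attached one by one, each by a 0-extension with a single edge; thus [Z] may have
    more than [d] elements. *)
Lemma star_rank x Z : (0 < d)%N -> x \notin Z -> (#|Z| <= rig_rank p (star x Z))%N.
Proof.
move=> d0; have [n] := ubnP #|Z|; elim: n Z => // n IH Z Zn xZ.
have [->|[z zZ]] := set_0Vmem Z; first by rewrite cards0.
have Z'n : (#|Z :\ z| < n)%N by move: Zn; rewrite (cardsD1 z) zZ.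
have xZ' : x \notin Z :\ z by rewrite !inE negb_and xZ orbT.
have xz : x != z by apply: contraNneq xZ => ->.
rewrite (cardsD1 z) zZ add1n -addn1.
apply: (@leq_trans (rig_rank p (star x (Z :\ z)) + #|[set x]|)).
  by rewrite cards1 leq_add2r IH.
apply: leq_trans (zero_extension (x := z) _ _ _) _.
- move=> s /imsetP [y]; rewrite !inE => /andP [yz yZ] ->.
  by rewrite !inE negb_or eq_sym xz eq_sym yz.
- by rewrite inE eq_sym.
- by rewrite cards1.
apply: rig_rankS; rewrite subUset imsetS ?subD1set //=.
apply/subsetP => s /imsetP [y]; rewrite inE => /eqP -> ->.
by rewrite setUC; apply: imset_f.
Qed.

(* The new vertex is specialised to the midpoint of a and b, where the rows of
   its two edges to a and b span the row of ab. *)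
Lemma one_extension F x Z a b : (forall s, s \in F -> x \notin s) -> x \notin Z ->
  #|Z| = d.+1 -> a \in Z -> b \in Z -> a != b ->
  ~~ (rig_row p [set a; b] <= rig_span p F)%MS ->
  (rig_rank p F + d.+1 <= rig_rank p (F :|: star x Z))%N.
Proof.
move=> xF xZ Zd aZ bZ ab abF.
have xa : x != a by apply: contraNneq xZ => ->.
have xb : x != b by apply: contraNneq xZ => ->.
pose q (y : T) : 'rV[R]_d := if y == x then 2%:R^-1 *: (p a + p b) else p y.
have qp s : x \notin s -> rig_row q s = rig_row p s.
  move=> xs; apply: rig_row_ext => y ys; rewrite /q ifN //.
  by apply: contraNneq xs => <-.
have qF (G : {set {set T}}) :
    (forall s, s \in G -> x \notin s) -> rig_span q G = rig_span p G.
  by move=> xG; apply: eq_bigr => s /xG /qp ->.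
apply: leq_trans (generic_rig_rank_ge q (F :|: star x Z) gp).
pose F' := [set a; b] |: F.
have xF' s : s \in F' -> x \notin s.
  by rewrite !inE => /orP [/eqP -> | /xF //]; rewrite !inE negb_or xa xb.
have xZb : x \notin Z :\ b by rewrite !inE negb_and xZ orbT.
(* The edge [ab] raises the rank of [F] by one, and a 0-extension along the other [d] vertices of
   [Z] gives the rest. *)
apply: (@leq_trans (rig_rank q F' + #|Z :\ b|)).
  have /eqP := Zd; rewrite (cardsD1 b) bZ add1n eqSS => /eqP ->.
  rewrite addnS -addSn leq_add2r !rig_rankE !qF // -!rig_rankE.
  exact: rig_rankU1.
apply: leq_trans (zero_extension_indep (x := x) _ xZb _) _ => //.
  move=> c c0.
  pose S := \sum_(z in Z :\ b) c z.
  (* As [x] is the midpoint, its total coefficient [S] is split evenly between [a] and [b], which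
     yields an affine relation among the d+1 generic points of [Z]. *)
  pose l y := if y == b then S / 2%:R else if y == a then S / 2%:R - c y else - c y.
  have aZb : a \in Z :\ b by rewrite !inE ab.
  have l0 : forall z, z \in Z -> l z = 0.
    apply: (generic_affine_indep gp); first by rewrite Zd.
      move: c0; rewrite (eq_bigr (fun z => c z *: q x - c z *: p z)); last first.
        move=> z; rewrite !inE => /andP [_ zZ]; rewrite scalerBr {2}/q ifN //.
        by apply: contraNneq xZ => <-.
      rewrite big_split /= -scaler_suml -/S sumrN /q eqxx => c0.
      rewrite (big_setD1 b) //= (big_setD1 a) //= /l eqxx (negPf ab) eqxx.
      rewrite (eq_bigr (fun z => - (c z *: p z))) => [|z]; last first.
        by rewrite !inE => /and3P [/negPf -> /negPf -> _]; rewrite scaleNr.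
      move: c0; rewrite (big_setD1 a) //= sumrN.
      move: (\sum_(z in _) _) => v c0.
      have -> : 0 = S *: (2%:R^-1 *: (p a + p b)) - (c a *: p a + v) by rewrite c0.
      by apply/rowP => k; rewrite !mxE; field.
    rewrite (big_setD1 b) //= (big_setD1 a) //= /l eqxx (negPf ab) eqxx.
    rewrite (eq_bigr (fun z => - c z)) => [|z]; last first.
      by rewrite !inE => /and3P [/negPf -> /negPf -> _].
    have : S = c a + \sum_(z in Z :\ b :\ a) c z by rewrite /S (big_setD1 a).
    by rewrite sumrN => ->; field.
  have S0 : S / 2%:R = 0 by have := l0 b bZ; rewrite /l eqxx.
  move=> z; rewrite !inE => /andP [/negPf zb zZ].
  have := l0 z zZ; rewrite /l zb S0 sub0r if_same => /eqP.
  by rewrite oppr_eq0 => /eqP.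
apply: rig_rank_span; apply: rig_span_subP => s.
rewrite !inE -orbA => /or3P [/eqP ->|sF|/imsetP [z]]; last first.
- rewrite !inE => /andP [_ zZ] ->; apply: rig_row_span.
  by rewrite in_setU mem_star ?orbT.
- by apply: rig_row_span; rewrite inE sF.
have -> : rig_row q [set a; b] =
    2%:R *: (rig_row q [set x; a] + rig_row q [set x; b]).
  have qx : q x = 2%:R^-1 *: (p a + p b) by rewrite /q eqxx.
  have qa : q a = p a by rewrite /q eq_sym (negPf xa).
  have qb : q b = p b by rewrite /q eq_sym (negPf xb).
  have two : (2%:R : R) != 0 by rewrite pnatr_eq0.
  apply: at_vertexP => w; transitivity (2%:R *: (at_vertex w (rig_row q [set x; a])
    + at_vertex w (rig_row q [set x; b]))); last first.
    by apply/rowP => k; rewrite !mxE.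
  have [->|wx] := eqVneq w x.
    rewrite at_rig_row_out ?inE ?negb_or ?xa ?xb // !at_rig_rowl // qx qa qb.
    by apply/rowP => k; rewrite !mxE; field.
  have [->|wa] := eqVneq w a.
    rewrite at_rig_rowl // at_rig_rowr //.
    rewrite at_rig_row_out ?inE ?negb_or ?ab 1?eq_sym ?xa //.
    by rewrite qx qa qb; apply/rowP => k; rewrite !mxE; field.
  have [->|wb] := eqVneq w b.
    rewrite at_rig_rowr // at_rig_row_out ?inE ?negb_or 1?eq_sym ?xb 1?eq_sym ?ab //.
    rewrite at_rig_rowr // qx qa qb.
    by apply/rowP => k; rewrite !mxE; field.
  by rewrite !at_rig_row_out ?inE ?negb_or ?wx ?wa ?wb // addr0 scaler0.
by rewrite scalemx_sub // addmx_sub // rig_row_span // in_setU mem_star ?orbT.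
Qed.

End Generic.

(** * Complete graphs *)

Section CompleteGraphs.
Variables (R : realType) (d : nat) (T : finType) (p : T -> 'rV[R]_d).
Implicit Types (F : {set {set T}}) (s A U V Z W : {set T}).

Lemma affine_dependency W : (d.+1 < #|W|)%N ->
  exists l : T -> R, [/\ exists2 w, w \in W & l w != 0,
    \sum_(w in W) l w *: p w = 0 & \sum_(w in W) l w = 0].
Proof.
move=> dW; pose M : 'M[R]_(#|W|, d + 1) :=
  row_mx (\matrix_(i < #|W|) p (enum_val i)) (const_mx 1).
have : kermx M != 0.
  rewrite kermx_eq0 /row_free; apply: contraTneq dW => <-.
  by rewrite -leqNgt (leq_trans (rank_leq_col _)) ?addn1.
case/rowV0Pn => v /sub_kermxP; rewrite mul_mx_row -row_mx0 => /eq_row_mx [vp v1] v0.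
pose l w := \sum_(i < #|W| | enum_val i == w) v 0 i.
have lE i : l (enum_val i) = v 0 i.
  by apply: big_pred1 => j; rewrite /= (inj_eq enum_val_inj).
exists l; split.
- case/rV0Pn: v0 => i vi; exists (enum_val i); first exact: enum_valP.
  by rewrite lE.
- rewrite (big_enum_val (fun w => l w *: p w)) -[RHS]vp mulmx_sum_row.
  by apply: eq_bigr => i _; rewrite rowK lE.
rewrite (big_enum_val l); have /rowP/(_ 0) := v1; rewrite !mxE; apply: etrans.
by apply: eq_bigr => i _; rewrite lE mxE mulr1.
Qed.

(** This lets stresses be summed over all ordered pairs, the diagonal included. *)
Lemma rig_row1 (x : T) : rig_row p [set x] = 0.
Proof.
apply: at_vertexP => w; rewrite at_vertex0; have [->|wx] := eqVneq w x; last first.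
  by rewrite at_rig_row_out ?inE.
apply/rowP => k; rewrite !mxE enum_rankK /= inE eqxx big_pred0 // => y.
by rewrite inE andbN.
Qed.

Lemma at_rig_row2 w i j : at_vertex w (rig_row p [set i; j]) =
  (i == w)%:R *: (p i - p j) + (j == w)%:R *: (p j - p i).
Proof.
have [->|ij] := eqVneq i j.
  by rewrite setUid rig_row1 at_vertex0 subrr scaler0 addr0.
have [<-|iw] := eqVneq i w.
  by rewrite at_rig_rowl // eq_sym (negPf ij) scale1r scale0r addr0.
have [<-|jw] := eqVneq j w.
  by rewrite at_rig_rowr // scale1r scale0r add0r.
by rewrite at_rig_row_out ?scale0r ?addr0 // !inE negb_or !(eq_sym w) iw.
Qed.

(* An affine dependency l induces the equilibrium stress l_i l_j. *)
Lemma affine_stress W (l : T -> R) :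
  \sum_(w in W) l w *: p w = 0 -> \sum_(w in W) l w = 0 ->
  \sum_(ij in setX W W) (l ij.1 * l ij.2) *: rig_row p [set ij.1; ij.2] = 0.
Proof.
move=> lp l0; apply: at_vertexP => w; rewrite at_vertex0 at_vertex_sum.
have H i : \sum_(j in W) l j *: (p i - p j) = 0.
  rewrite (eq_bigr (fun j => l j *: p i - l j *: p j)) => [|j _]; last exact: scalerBr.
  by rewrite big_split /= sumrN lp -scaler_suml l0 scale0r subrr.
have G : \sum_(i in W) \sum_(j in W) (l i * l j * (i == w)%:R) *: (p i - p j) = 0.
  rewrite big1 // => i iW.
  transitivity ((l i * (i == w)%:R) *: \sum_(j in W) l j *: (p i - p j)).
    by rewrite scaler_sumr; apply: eq_bigr => j _; rewrite scalerA mulrAC.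
  by rewrite H scaler0.
rewrite (eq_bigl (fun ij => (ij.1 \in W) && (ij.2 \in W))); last first.
  by move=> [i j]; rewrite inE.
rewrite -(pair_big_dep (fun i => i \in W) (fun _ j => j \in W)
  (fun i j => (l i * l j) *: at_vertex w (rig_row p [set i; j]))) /=.
transitivity (\sum_(i in W) \sum_(j in W) (l i * l j * (i == w)%:R) *: (p i - p j) +
  \sum_(i in W) \sum_(j in W) (l i * l j * (i == w)%:R) *: (p i - p j)); last first.
  by rewrite G addr0.
rewrite [X in _ = _ + X]exchange_big -big_split.
apply: eq_bigr => i _; rewrite -big_split; apply: eq_bigr => j _ /=.
by rewrite at_rig_row2 scalerDr !scalerA (mulrC (l j)).
Qed.

(** In the stress of [affine_stress] the edge [xy] occurs as two ordered pairs, so with coefficient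
    [2 * l x * l y], and can be solved for. *)
Lemma dependency_span W (l : T -> R) x y m (S : 'M_(m, _)) :
  \sum_(w in W) l w *: p w = 0 -> \sum_(w in W) l w = 0 ->
  x \in W -> y \in W -> x != y -> l x != 0 -> l y != 0 ->
  (forall i j, i \in W -> j \in W -> i != j -> [set i; j] != [set x; y] ->
     (rig_row p [set i; j] <= S)%MS) ->
  (rig_row p [set x; y] <= S)%MS.
Proof.
move=> lp l0 xW yW xy lx ly WS.
have := affine_stress lp l0.
rewrite (bigD1 (x, y)) ?inE ?xW ?yW //= (bigD1 (y, x)) /=; last first.
  by rewrite inE /= yW xW xpair_eqE negb_and eq_sym xy.
rewrite (setUC [set y]) addrA -scalerDl => /eqP; rewrite addr_eq0 => /eqP e.
have c0 : l x * l y + l y * l x != 0.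
  by rewrite (mulrC (l y)) -mulr2n mulrn_eq0 /= mulf_neq0.
rewrite -[rig_row _ _]scale1r -(mulVf c0) -scalerA scalemx_sub // e.
rewrite -scaleN1r scalemx_sub // summx_sub // => -[i j] /=.
rewrite !inE !xpair_eqE /= => /andP [/andP [/andP [iW jW] n1] n2].
rewrite scalemx_sub //; have [->|ij] := eqVneq i j.
  by rewrite setUid rig_row1 sub0mx.
apply: WS => //; apply/negP => /eqP/setP e'.
move: (e' i) (e' j); rewrite !inE !eqxx ?orbT /= => /esym/orP h1 /esym/orP h2.
case: h1 => /eqP h1; case: h2 => /eqP h2; move: n1 n2 ij; rewrite h1 h2 !eqxx //.
Qed.

Lemma rig_span_all_edges U m (S : 'M_(m, _)) :
  (forall i j, i \in U -> j \in U -> i != j -> (rig_row p [set i; j] <= S)%MS) ->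
  (rig_span p (all_edges U) <= S)%MS.
Proof.
move=> H; apply: rig_span_subP => s; rewrite inE => /andP [sU /cards2P [i [j [ij e]]]].
by rewrite e; move: sU; rewrite e subUset !sub1set => /andP [iU jU]; apply: H.
Qed.

Lemma mem_all_edges U i j : i \in U -> j \in U -> i != j -> [set i; j] \in all_edges U.
Proof. by move=> iU jU ij; rewrite inE subUset !sub1set iU jU cards2 ij. Qed.

Hypothesis gp : generic p.

(** For [y] in [A], the d+2 points [x], [y] and [d] points of [Z] have an affine dependency with no
    zero coefficient. Its stress expresses [xy] by edges of [A] and edges from [x] to [Z]. *)
Lemma rigid_extension A x Z : x \notin A -> Z \subset A -> (d <= #|Z|)%N ->
  (rig_span p (all_edges (x |: A)) <= rig_span p (all_edges A :|: star x Z))%MS.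
Proof.
move=> xA ZA dZ; have {dZ} [Y YZ dY] := subset_of_card dZ.
have YA := subset_trans YZ ZA.
set S := rig_span p (all_edges A :|: star x Z).
have inA i j : i \in A -> j \in A -> i != j -> (rig_row p [set i; j] <= S)%MS.
  by move=> iA jA ij; apply: rig_row_span; rewrite in_setU mem_all_edges.
have inY z : z \in Y -> (rig_row p [set x; z] <= S)%MS.
  move=> zY; apply: rig_row_span; rewrite in_setU mem_star ?orbT //.
  exact: (subsetP YZ).
have inx y : y \in A -> (rig_row p [set x; y] <= S)%MS.
  move=> yA; have [/inY //|yY] := boolP (y \in Y).
  have xy : x != y by apply: contraNneq xA => ->.
  have xY : x \notin Y by apply: contra xA; apply: (subsetP YA).
  have xyY : x \notin y |: Y by rewrite !inE negb_or xy.
  pose W := x |: (y |: Y).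
  have [|l [[w wW lw] lp l0]] := @affine_dependency W.
    by rewrite !cardsU1 xyY yY dY.
  (* A zero coefficient would leave a nontrivial affine relation among d+1 generic points. *)
  have nz u : u \in W -> l u != 0.
    move=> uW; apply: contra lw => /eqP lu.
    have [-> |wu] := eqVneq w u; first by rewrite lu.
    apply/eqP; apply: (generic_affine_indep gp (Z := W :\ u)).
    - suff: (#|W| = d.+2) by rewrite (cardsD1 u) uW add1n => /eq_add_S ->.
      by rewrite !cardsU1 xyY yY dY.
    - by move: lp; rewrite (big_setD1 u) //= lu scale0r add0r.
    - by move: l0; rewrite (big_setD1 u) //= lu add0r.
    - by rewrite in_setD1 wu.
  apply: (dependency_span lp l0) => //; rewrite ?nz //; rewrite ?inE ?eqxx ?orbT //.
  move=> i j; rewrite !inE.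
  have YA' u : (u == y) || (u \in Y) -> u \in A.
    by case/orP => [/eqP -> //|]; apply: (subsetP YA).
  case/predU1P => [->|iY']; case/predU1P => [->|jY'] ij ne.
  - by rewrite eqxx in ij.
  - by case/predU1P: jY' ne => [->|/inY //]; rewrite eqxx.
  - rewrite setUC; case/predU1P: iY' ne => [->|/inY //].
    by rewrite setUC eqxx.
  - by apply: inA; rewrite ?YA'.
apply: rig_span_all_edges => i j; rewrite !inE.
case/predU1P => [->|iA]; case/predU1P => [->|jA] ij.
- by rewrite eqxx in ij.
- exact: inx.
- by rewrite setUC inx.
- exact: inA.
Qed.

Lemma rig_rank_all_edgesS A x : x \notin A -> (d <= #|A|)%N ->
  (rig_rank p (all_edges (x |: A)) <= rig_rank p (all_edges A) + d)%N.
Proof.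
move=> xA dA; have [Z ZA Zd] := subset_of_card dA.
apply: leq_trans (rig_rank_span (rigid_extension xA ZA _)) _; first by rewrite Zd.
apply: leq_trans (rig_rankU _ _ _) _; rewrite leq_add2l.
apply: leq_trans (rig_rank_card _ _) _.
by rewrite -Zd leq_imset_card.
Qed.

Lemma rig_rank_all_edges_ge A x : x \notin A ->
  (rig_rank p (all_edges A) + minn d #|A| <= rig_rank p (all_edges (x |: A)))%N.
Proof.
move=> xA; apply: leq_trans (zero_extension_min gp _ xA) _.
  move=> s; rewrite inE => /andP [/subsetP sA _].
  by apply: contra xA; apply: sA.
apply: rig_rankS; apply/subsetP => s; rewrite in_setU => /orP [|/imsetP [z zA ->]].
  rewrite !inE => /andP [sA ->]; rewrite andbT.
  exact: subset_trans sA (subsetUr _ _).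
apply: mem_all_edges; rewrite ?setU11 // ?inE ?zA ?orbT //.
by apply: contraNneq xA => ->.
Qed.

Lemma binS2_sq n : ('C(n, 2) + 'C(n.+1, 2) = n * n)%N.
Proof. by elim: n => // n IH; rewrite !binS ?bin1 ?bin0 in IH *; nia. Qed.

(** Up to [d] vertices all edges are independent, by 0-extensions; from then on each new vertex adds
    exactly [d], the upper bound being [rigid_extension]. *)
Lemma rig_rank_all_edges U : (d <= #|U|)%N ->
  (rig_rank p (all_edges U) + 'C(d.+1, 2) = d * #|U|)%N.
Proof.
have card_all (V : {set T}) : #|@all_edges T V| = 'C(#|V|, 2).
  by rewrite -cards_draws; apply: eq_card => s; rewrite !inE.
have small n (V : {set T}) : #|V| = n -> (n <= d)%N ->
    (rig_rank p (all_edges V) = 'C(n, 2))%N.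
  move=> Vn nd; apply/eqP; rewrite eqn_leq -{1}Vn -card_all rig_rank_card /=.
  elim: n V Vn nd => // n IH V Vn nd.
  have /card_gt0P [x xV] : (0 < #|V|)%N by rewrite Vn.
  have Vn' : #|V :\ x| = n by move: Vn; rewrite (cardsD1 x) xV add1n => -[].
  have := rig_rank_all_edges_ge (x := x) (A := V :\ x).
  rewrite !inE eqxx setD1K // Vn' => /(_ isT).
  apply: leq_trans; rewrite binS bin1 (minn_idPr (ltnW nd)) leq_add2r.
  by apply: IH => //; apply: ltnW.
move=> dU; move eqk : (#|U| - d)%N => k; elim: k U dU eqk => [|k IH] U dU eqk.
  have Ud : #|U| = d by lia.
  by rewrite (small d) // Ud binS2_sq.
have /card_gt0P [x xU] : (0 < #|U|)%N by lia.
have Uc := cardsD1 x U; rewrite xU add1n in Uc.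
have nx : x \notin U :\ x by rewrite !inE eqxx.
have := rig_rank_all_edges_ge nx; have := rig_rank_all_edgesS nx.
rewrite setD1K // (minn_idPl _); last by lia.
have := IH (U :\ x); rewrite Uc mulnS; lia.
Qed.

Lemma rig_rank_le U F : F \subset all_edges U -> (d <= #|U|)%N ->
  (rig_rank p F + 'C(d.+1, 2) <= d * #|U|)%N.
Proof.
by move=> FU dU; rewrite -(rig_rank_all_edges dU) leq_add2r rig_rankS.
Qed.

End CompleteGraphs.

(** * Rank across a vertex separator *)

Section Separation.
Variables (R : realType) (d : nat) (T : finType) (p : T -> 'rV[R]_d).
Implicit Types (F E : {set {set T}}) (s S : {set T}).

(** The projection [f] to the columns of [S] is injective on the row space of [M]. *)
Lemma rank_le_coords S m (M : 'M[R]_(m, ncols d T)) :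
  (forall u : 'rV[R]_(ncols d T), (u <= M)%MS ->
     (forall w, w \in S -> at_vertex w u = 0) -> u = 0) ->
  (\rank M <= #|S| * d)%N.
Proof.
move=> H; pose J := setX S [set: 'I_d].
pose f : 'M[R]_(ncols d T, #|J|) :=
  \matrix_(i, j) (i == enum_rank (enum_val j : T * 'I_d))%:R.
have /mxrank_injP <- : (M :&: kermx f)%MS == 0.
  apply/rowV0P => u; rewrite sub_capmx => /andP [uM /sub_kermxP uf].
  apply: H => // w wS; apply/rowP => k; rewrite !mxE.
  have wkJ : (w, k) \in J by rewrite !inE wS.
  have /rowP/(_ (enum_rank_in wkJ (w, k))) := uf; rewrite !mxE.
  rewrite (bigD1 (enum_rank (w, k))) //= mxE enum_rankK_in // eqxx mulr1.
  rewrite big1 ?addr0 // => i iwk; rewrite mxE enum_rankK_in //.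
  by rewrite (negPf iwk) mulr0.
by apply: leq_trans (rank_leq_col _) _; rewrite cardsX cardsT card_ord.
Qed.

Lemma sum_at_rig_row (s : {set T}) : #|s| == 2 ->
  \sum_w at_vertex w (rig_row p s) = 0.
Proof.
move=> /cards2P [x [y [xy ->]]].
rewrite (bigD1 x) //= (bigD1 y) 1?eq_sym //= big1 ?addr0.
  by rewrite at_rig_rowl // at_rig_rowr // addrC addrA subrK subrr.
by move=> w /andP [wx wy]; rewrite at_rig_row_out // !inE negb_or wx.
Qed.

Lemma sum_at_span F u : (forall s, s \in F -> #|s| == 2) -> (u <= rig_span p F)%MS ->
  \sum_w at_vertex w u = 0.
Proof.
move=> F2 /rig_spanP [c ->].
under eq_bigr => w _ do rewrite at_vertex_sum.
rewrite exchange_big /= big1 // => s sF.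
by rewrite -scaler_sumr sum_at_rig_row ?scaler0 ?F2.
Qed.

(** A vector in both row spaces vanishes outside [S], and its blocks sum to zero by translation
    invariance. Hence the blocks at all but one vertex of [S] determine it. *)
Lemma separation_rank S E1 E2 :
  (forall s, s \in E1 -> #|s| == 2) ->
  (forall s1 s2, s1 \in E1 -> s2 \in E2 -> s1 :&: s2 \subset S) ->
  (rig_rank p E1 + rig_rank p E2 <= rig_rank p (E1 :|: E2) + d * #|S|.-1)%N.
Proof.
move=> E12 ES; rewrite !rig_rankE rig_spanU -mxrank_sum_cap leq_add2l mulnC.
have out u w : (u <= rig_span p E1 :&: rig_span p E2)%MS -> w \notin S ->
    at_vertex w u = 0.
  rewrite sub_capmx => /andP [u1 u2] wS.
  have [/exists_inP [s sE ws]|nE] := boolP [exists s in E1, w \in s]; last first.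
    apply: (at_span_out _ u1) => s sE; apply: contra nE => ws.
    by apply/exists_inP; exists s.
  apply: (at_span_out _ u2) => s' s'E; apply: contra wS => ws'.
  by apply: (subsetP (ES _ _ sE s'E)); rewrite inE ws.
(* For empty [S] the predecessor is 0 as well, and the row spaces meet trivially. *)
have [S0|[s0 s0S]] := set_0Vmem S.
  have := @rank_le_coords set0 _ (rig_span p E1 :&: rig_span p E2)%MS.
  rewrite S0 !cards0; apply=> u uM _.
  by apply: at_vertexP => w; rewrite at_vertex0 out // S0 inE.
rewrite (cardsD1 s0) s0S /=; apply: rank_le_coords => u uM uS.
have other w : w != s0 -> at_vertex w u = 0.
  move=> ws0; have [wS|wS] := boolP (w \in S); last exact: out.
  by apply: uS; rewrite !inE ws0.
apply: at_vertexP => w; rewrite at_vertex0.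
have [->|/other //] := eqVneq w s0.
move: uM; rewrite sub_capmx => /andP [/(sum_at_span E12) + _].
by rewrite (bigD1 s0) //= big1 ?addr0 // => w' /other.
Qed.

End Separation.

(** * Connectivity *)

Section Connectivity.
Variable T : finType.
Implicit Types (F : {set {set T}}) (U S X : {set T}).

(** Vertex and edge sets vary inside the fixed type [T], so that one configuration serves all
    subgraphs. *)
Definition connected_on U F k : Prop :=
  (k < #|U|)%N /\
  forall S, (#|S| < k)%N -> forall u v, u \in U -> v \in U ->
    u \notin S -> v \notin S ->
    connect [rel x y | [&& [set x; y] \in F, x \notin S & y \notin S]] u v.

Definition nbrs F v : {set T} := [set u | [set v; u] \in F].

Lemma connected_on_closed U F k S X u v : connected_on U F k -> (#|S| < k)%N ->
  (forall x y, [set x; y] \in F -> x \notin S -> y \notin S -> x \in X -> y \in X) ->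
  u \in U -> u \notin S -> u \in X -> v \in U -> v \notin S -> v \in X.
Proof.
move=> [_ /(_ S) cU] Sk clX uU uS uX vU vS.
have /closed_connect <- // := cU Sk u v uU vU uS vS.
move=> x y /and3P [xyF xS yS]; apply/idP/idP; first exact: clX.
by apply: clX; rewrite // setUC.
Qed.

Lemma edge_neq U F x y : F \subset all_edges U -> [set x; y] \in F -> x != y.
Proof.
move=> /subsetP FU /FU; rewrite inE => /andP [_]; rewrite cards2.
by case: (x != y).
Qed.

Lemma edge_in U F x y : F \subset all_edges U -> [set x; y] \in F ->
  x \in U /\ y \in U.
Proof.
move=> /subsetP FU /FU; rewrite inE subUset !sub1set => /andP [/andP [xU yU] _].
by [].
Qed.

Lemma nbrs_sub U F v : F \subset all_edges U -> nbrs F v \subset U.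
Proof. by move=> FU; apply/subsetP => u; rewrite inE => /(edge_in FU) []. Qed.

Lemma nbrsN U F v : F \subset all_edges U -> v \notin nbrs F v.
Proof. by move=> FU; rewrite inE; apply/negP => /(edge_neq FU); rewrite eqxx. Qed.

(** Otherwise fewer than [k] neighbours separate [v] from a remaining vertex. *)
Lemma connected_on_degree U F k v : F \subset all_edges U ->
  connected_on U F k -> v \in U -> (k <= #|nbrs F v|)%N.
Proof.
move=> FU cU vU; rewrite leqNgt; apply/negP => Nk.
have : (#|v |: nbrs F v| < #|U|)%N.
  by case: cU => kU _; rewrite cardsU1 (nbrsN _ FU); apply: leq_ltn_trans kU.
rewrite ltnNge; apply/negP/negPn/subset_leq_card/subsetP => w wU.
rewrite !inE; case: (boolP ([set v; w] \in F)) => [|nw]; first by rewrite orbT.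
rewrite orbF -in_set1; apply: (connected_on_closed (u := v) cU Nk) => //.
- by move=> x y xyF _ yN /set1P xv; rewrite xv in xyF; rewrite inE xyF in yN.
- exact: nbrsN FU.
- by rewrite set11.
- by rewrite inE.
Qed.

Lemma connected_onW U F k k' : (k' <= k)%N -> connected_on U F k -> connected_on U F k'.
Proof.
move=> kk [kU cU]; split; first exact: leq_ltn_trans kU.
by move=> S Sk; apply: cU; apply: leq_trans kk.
Qed.

Lemma connected_onS U F F' k : F \subset F' -> connected_on U F k -> connected_on U F' k.
Proof.
move=> /subsetP FF' [kU cU]; split=> // S Sk u v uU vU uS vS.
apply: connect_sub (cU S Sk u v uU vU uS vS) => x y /and3P [/FF' xyF xS yS].
by apply: connect1; rewrite /= xyF xS.
Qed.

Lemma connected_on_del U F k v : F \subset all_edges U -> v \in U ->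
  connected_on U F k.+1 -> connected_on (U :\ v) (F :&: all_edges (U :\ v)) k.
Proof.
move=> FU vU [kU cU]; split; first by move: kU; rewrite (cardsD1 v) vU.
move=> S Sk x y; rewrite !inE => /andP [xv xU] /andP [yv yU] xS yS.
have Sk' : (#|v |: S| < k.+1)%N by rewrite cardsU1; case: (_ \notin _) => //; apply: ltnW.
apply: connect_sub (cU _ Sk' x y xU yU _ _); rewrite ?inE ?negb_or ?xv ?yv //.
move=> a b /and3P [abF]; rewrite !inE !negb_or => /andP [av aS] /andP [bv bS].
apply: connect1; rewrite /= aS bS !andbT in_setI abF mem_all_edges ?inE ?av ?bv //=.
- by case: (edge_in FU abF).
- by case: (edge_in FU abF).
- exact: edge_neq FU abF.
Qed.

(* A path through v can avoid it, as the neighbours of v are pairwise adjacent. *)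
Lemma connected_on_simplicial U F k v : F \subset all_edges U -> v \in U ->
  connected_on U F k -> all_edges (nbrs F v) \subset F -> (k.+1 < #|U|)%N ->
  connected_on (U :\ v) (F :&: all_edges (U :\ v)) k.
Proof.
move=> FU vU cU clq kU; split; first by move: kU; rewrite (cardsD1 v) vU.
move=> S Sk x y; rewrite !inE => /andP [xv xU] /andP [yv yU] xS yS.
set e := [rel _ _ | _].
pose Y := [set z | connect e x z].
(* The component [Y] of [x] after the deletion, with [v] added if adjacent to it, is closed under
   the edges of the undeleted graph that avoid [S]. *)
pose X := if [exists c in Y, [set v; c] \in F] then v |: Y else Y.
have eY a b : a \in Y -> a != v -> b != v -> [set a; b] \in F ->
    a \notin S -> b \notin S -> b \in Y.
  rewrite !inE => xa av bv abF aS bS; apply: connect_trans xa (connect1 _).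
  rewrite /= aS bS !andbT in_setI abF mem_all_edges ?inE ?av ?bv //=.
  - by case: (edge_in FU abF).
  - by case: (edge_in FU abF).
  - exact: edge_neq FU abF.
have Yv a : a \in Y -> (a != v) /\ (a \notin S).
  rewrite inE => /connectP [q]; elim/last_ind: q => [_ ->|q z _]; first by [].
  rewrite rcons_path last_rcons => /andP [_ /and3P [+ _ zS]] ->.
  rewrite in_setI => /andP [_]; rewrite inE => /andP [+ _].
  by rewrite subUset !sub1set !inE => /andP [_ /andP [-> _]].
have YX : Y \subset X by rewrite /X; case: ifP => // _; apply: subsetUr.
have : y \in X.
  apply: (connected_on_closed (u := x) cU Sk) => //; last first.
    by apply: (subsetP YX); rewrite inE connect0.
  move=> a b abF aS bS aX; have [bv|bv] := eqVneq b v.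
    have av : a != v by rewrite -bv; apply: edge_neq FU abF.
    have aY : a \in Y by move: aX; rewrite /X; case: ifP => //; rewrite !inE (negPf av).
    rewrite /X bv ifT ?setU11 //; apply/exists_inP; exists a => //.
    by rewrite setUC -bv.
  apply: (subsetP YX); have [av|av] := eqVneq a v; last first.
    have aY : a \in Y by move: aX; rewrite /X; case: ifP => //; rewrite !inE (negPf av).
    exact: (eY a).
  move: aX; rewrite /X av.
  case: ifP => [/exists_inP [c cY vc] _|_ /Yv []]; last by rewrite eqxx.
  have [<- //|cb] := eqVneq c b.
  case: (Yv c cY) => cv cS; apply: (eY c) => //.
  by apply: (subsetP clq); apply: mem_all_edges; rewrite ?inE // -av.
have : y \in Y -> connect e x y by rewrite inE.
by rewrite /X; case: ifP => // _ yY; rewrite in_setU1 (negPf yv).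
Qed.

End Connectivity.

(** * Highly connected graphs are rigid *)

Section Averaging.
Variables (K : realFieldType) (T : finType) (N : T -> {set T}).
Variables (rho : {set T} -> K) (g b : T -> {set T} -> K) (U : {set T}).
Implicit Types (W J : {set T}).

(* b v J plays the role of the expected gain of v when the elements of v |: J
   are inserted in random order. *)
Lemma averaging W : 0 <= rho set0 -> (forall v, v \notin N v) ->
  (forall W v, W \subset U -> v \in W -> rho (W :\ v) + g v (N v :&: W) <= rho W) ->
  (forall v J, v \in U -> J \subset N v ->
     #|J|.+1%:R * b v J <= \sum_(u in J) b v (J :\ u) + g v J) ->
  W \subset U -> \sum_(v in W) b v (N v :&: W) <= rho W.
Proof.
move=> rho0 Nv rhoW bJ; have [n] := ubnP #|W|; elim: n W => // n IH W Wn WU.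
have [->|[w0 w0W]] := set_0Vmem W; first by rewrite big_set0.
have W0 : 0 < #|W|%:R :> K by rewrite ltr0n card_gt0; apply/set0Pn; exists w0.
(* Averaging over the element [w] inserted last: induction handles [W :\ w], and [g] bounds the gain
   of [w]. *)
rewrite -(ler_pM2l W0); apply: (@le_trans _ _
  (\sum_(w in W) (\sum_(v in W :\ w) b v (N v :&: (W :\ w)) + g w (N w :&: W))));
  last first.
  rewrite mulr_natl -sumr_const; apply: ler_sum => w wW.
  apply: le_trans (rhoW W w WU wW); rewrite lerD2r; apply: IH.
    by move: Wn; rewrite (cardsD1 w) wW.
  by apply: subset_trans WU; apply: subD1set.
rewrite big_split /=.
rewrite (exchange_big_dep (fun v => v \in W)) /=; last first.
  by move=> w v _; rewrite !inE => /andP [].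
rewrite -big_split mulr_sumr /=; apply: ler_sum => v vW.
set J := N v :&: W.
have vJ : v \notin J by rewrite inE negb_and Nv.
have JW : J \subset W by apply: subsetIr.
(* For fixed [v], removing [w] changes its neighbourhood only if [w] is in [J]; the other
   [#|W| - #|J|.+1] choices contribute [b v J] each. *)
rewrite (bigID (fun w => w \in J)) /=.
have -> : \sum_(w | (w \in W) && (v \in W :\ w) && (w \in J)) b v (N v :&: (W :\ w)) =
    \sum_(w in J) b v (J :\ w).
  apply: eq_big => [w|w _]; last by rewrite setIDA.
  rewrite !inE vW andbT; case: (boolP (w \in N v)) => wN; rewrite ?andbF //=.
  by case: (w \in W); rewrite ?andbF //= andbT; apply: contraNneq (Nv v) => {1}->.
have -> : \sum_(w | (w \in W) && (v \in W :\ w) && (w \notin J)) b v (N v :&: (W :\ w)) =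
    (#|W| - #|J|.+1)%:R * b v J.
  rewrite (eq_bigl (fun w => w \in W :\: (v |: J))) => [|w]; last first.
    rewrite !inE vW andbT negb_or (eq_sym v).
    by case: (w \in W); rewrite ?andbF //= !andbT.
  rewrite (eq_bigr (fun=> b v J)) => [|w]; last first.
    rewrite !inE => /andP [+ wW]; rewrite wW andbT negb_or => /andP [_ wN].
    congr (b v _); apply/setP => u; rewrite !inE.
    by case: (eqVneq u w) => [->|] //=; rewrite (negPf wN).
  rewrite sumr_const mulr_natl cardsD; congr (_ *+ (_ - _)).
  by rewrite (setIidPr _) ?cardsU1 ?vJ // subUset sub1set vW.
have JW' : (#|J|.+1 <= #|W|)%N.
  by have : (#|v |: J| <= #|W|)%N; [rewrite subset_leq_card // subUset sub1set vW
    | rewrite cardsU1 vJ].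
have := bJ v J (subsetP WU v vW) (subsetIl _ _).
rewrite natrB // mulrBl addrAC -lerBlDr; lra.
Qed.

End Averaging.

(** * A closed formula for the expected gain *)

Section Certificate.
Variables (d : nat) (T : finType) (cl : pred {set T}).
Hypothesis d0 : (0 < d)%N.
Hypothesis clS : forall J J' : {set T}, J' \subset J -> cl J -> cl J'.
Implicit Type J : {set T}.

(** The sum of the deficits [d - j] over 0 <= j <= d. *)
Let C : rat := (d%:R * d.+1%:R) / 2.

(* For a clique and for #|J| <= d this is the mean of minn d j over 0 <= j <= #|J|.
   For other sets it solves the recursion of expected_gain_le in the extremal case
   where exactly one element has to be removed from J to obtain a clique. *)
Definition expected_gain J : rat :=
  if (#|J| <= d)%N then #|J|%:R / 2
  else if cl J then d%:R - C / #|J|.+1%:R else d%:R + 2^-1 - C / #|J|%:R.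

Definition gain J : nat := (minn d #|J| + ((d < #|J|) && ~~ cl J))%N.

(** At size [d] all three formulas give [d / 2], so the recursion can step down to that size without
    a further case. *)
Lemma expected_gain_ge J : (d <= #|J|)%N -> expected_gain J =
  if cl J then d%:R - C / #|J|.+1%:R else d%:R + 2^-1 - C / #|J|%:R.
Proof.
rewrite /expected_gain; case: ltngtP => // <- _.
have d1 : (d%:R : rat) != 0 by rewrite pnatr_eq0 -lt0n.
have d2 : (d.+1%:R : rat) != 0 by rewrite pnatr_eq0.
rewrite /C; case: ifP => _; move: d2; rewrite -natr1 => d2; field => //.
Qed.

Lemma expected_gain_le J :
  ((d < #|J|)%N -> ~~ cl J -> forall u v, u \in J -> v \in J ->
     cl (J :\ u) -> cl (J :\ v) -> u = v) ->
  #|J|.+1%:R * expected_gain J <= \sum_(u in J) expected_gain (J :\ u) + (gain J)%:R.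
Proof.
move=> J1; have cD u : u \in J -> #|J| = #|J :\ u|.+1.
  by move=> uJ; rewrite (cardsD1 u) uJ.
have [jd|dj] := leqP #|J| d.
  rewrite (eq_bigr (fun=> (#|J|.-1%:R / 2))) => [|u uJ]; last first.
    by rewrite /expected_gain (cD u uJ) /= ifT // -ltnS -(cD u) //; apply: leq_trans jd _.
  rewrite /gain (minn_idPr jd) ltnNge jd addn0 sumr_const /expected_gain jd.
  case: #|J| => [|n]; first by rewrite mul0r mulr0 mulr0n addr0.
  rewrite -[X in _ <= X + _]mulr_natl /= -[n.+2%:R]natr1 -[n.+1%:R]natr1; lra.
have J0 : (#|J|%:R : rat) != 0 by rewrite pnatr_eq0 -lt0n (leq_trans d0) // ltnW.
have J0' : (#|J|.+1%:R : rat) != 0 by rewrite pnatr_eq0.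
rewrite expected_gain_ge ?(ltnW dj) // /gain dj (minn_idPl (ltnW dj)).
have eD u : u \in J -> expected_gain (J :\ u) =
    if cl (J :\ u) then d%:R - C / #|J|%:R else d%:R + 2^-1 - C / #|J|.-1%:R.
  move=> uJ; have cJ := cD u uJ.
  by rewrite expected_gain_ge; [rewrite cJ | rewrite -ltnS -cJ].
case: (boolP (cl J)) => clJ.
  rewrite (eq_bigr (fun=> d%:R - C / #|J|%:R)) => [|u uJ]; last first.
    by rewrite eD // (clS (subD1set J u)).
  rewrite sumr_const -[X in _ <= X + _]mulr_natl addn0 mulrBr mulrBr.
  rewrite [X in _ - X <= _]mulrC divfK // [X in _ - X + _]mulrC divfK //.
  by rewrite -[#|J|.+1%:R]natr1; lra.
(* [u0] is the only element whose removal can leave a clique; if there is no such element, any one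
   serves. *)
have [u0 u0J u0P] : exists2 u0, u0 \in J & forall u, u \in J -> u != u0 -> ~~ cl (J :\ u).
  have [/exists_inP [u uJ clu]|nex] := boolP [exists u in J, cl (J :\ u)].
    exists u => // v vJ vu; apply: contra vu => clv; apply/eqP.
    exact: (J1 dj clJ).
  have /card_gt0P [u uJ] : (0 < #|J|)%N by apply: leq_trans dj.
  exists u => // v vJ _; apply: contra nex => clv; apply/exists_inP.
  by exists v.
have jd : (d%:R * d.+1%:R <= #|J|.-1%:R * #|J|%:R :> rat).
  by rewrite -!natrM ler_nat leq_mul // -ltnS prednK //; apply: leq_trans dj.
have J1' : (#|J|%:R : rat) = #|J|.-1%:R + 1.
  by rewrite natr1 prednK //; apply: leq_trans dj.
have J1p : 0 < (#|J|.-1%:R : rat) by rewrite ltr0n; move: dj d0; lia.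
have dp : 0 < (d%:R : rat) by rewrite ltr0n.
have [j jE] : exists j : rat, j = #|J|.-1%:R by exists #|J|.-1%:R.
rewrite -jE in J1' J1p jd; rewrite -jE in eD.
(* The clique value is the smaller of the two, because [#|J|] exceeds [d]; so the case of one clique
   is the extremal one, and there equality holds. *)
have lo : d%:R - C / #|J|%:R <= expected_gain (J :\ u0).
  rewrite eD //; case: ifP => // _.
  suff : C / j - C / #|J|%:R <= 2^-1 by lra.
  have -> : C / j - C / #|J|%:R = C / (j * #|J|%:R).
    by rewrite J1'; field; apply/andP; split; lra.
  rewrite ler_pdivrMr ?mulr_gt0 //; last by rewrite J1'; lra.
  by rewrite /C; lra.
rewrite (bigD1 u0) //= (eq_bigr (fun=> d%:R + 2^-1 - C / j)); last first.
  by move=> u /andP [uJ uu]; rewrite eD // (negPf (u0P u uJ uu)).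
rewrite sumr_const; have -> : #|[pred i in J | i != u0]| = #|J|.-1.
  by rewrite (cD u0) //=; apply: eq_card => u; rewrite !inE andbC.
rewrite -[X in _ <= _ + X + _]mulr_natl -jE /= natrD -[#|J|.+1%:R]natr1.
suff : (#|J|%:R + 1) * (d%:R + 2^-1 - C / #|J|%:R) =
  d%:R - C / #|J|%:R + j * (d%:R + 2^-1 - C / j) + (d%:R + 1) by lra.
by rewrite J1'; field; apply/andP; split; lra.
Qed.

(** The source of the bound d(d+1): [C / #|J|] is at most one half exactly from this size on. *)
Lemma expected_gain_full J : ~~ cl J -> (d * d.+1 <= #|J|)%N -> d%:R <= expected_gain J.
Proof.
move=> clJ dJ; rewrite expected_gain_ge ?(negPf clJ); last first.
  by apply: leq_trans dJ; rewrite leq_pmulr.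
suff : C / #|J|%:R <= 2^-1 by lra.
rewrite ler_pdivrMr; last by rewrite ltr0n; apply: leq_trans dJ; rewrite muln_gt0 d0.
by have : d%:R * d.+1%:R <= #|J|%:R :> rat by [rewrite -natrM ler_nat]; rewrite /C; lra.
Qed.

End Certificate.

(** * Closed graphs and rigidity *)

Section Rigidity.
Variables (R : realType) (d : nat) (T : finType) (p : T -> 'rV[R]_d).
Hypotheses (gp : generic p) (d0 : (0 < d)%N).
Implicit Types (F : {set {set T}}) (A U W S J : {set T}).

(** For [F] inside [all_edges U]: a flat of the rigidity matroid of the complete graph on [U]. *)
Definition closed_on U F : Prop :=
  forall s, s \in all_edges U -> (rig_row p s <= rig_span p F)%MS -> s \in F.

Lemma all_edgesS U W : U \subset W -> all_edges U \subset all_edges W.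
Proof.
move=> UW; apply/subsetP => s; rewrite !inE => /andP [sU ->]; rewrite andbT.
exact: subset_trans UW.
Qed.

Lemma all_edges_notin v U s : s \in all_edges (U :\ v) -> v \notin s.
Proof.
rewrite inE => /andP [/subsetP sU _]; apply/negP => /sU.
by rewrite !inE eqxx.
Qed.

Lemma star_sub F v W : W \subset nbrs F v -> star v W \subset F.
Proof.
by move=> /subsetP WN; apply/subsetP => s /imsetP [z /WN + ->]; rewrite inE.
Qed.

Lemma closed_clique_ext U F A x J : closed_on U F -> x \in U -> A \subset U ->
  x \notin A -> all_edges A \subset F -> J \subset A -> J \subset nbrs F x ->
  (d <= #|J|)%N -> all_edges (x |: A) \subset F.
Proof.
move=> cF xU AU xA AF JA JN dJ.
have H : (rig_span p (all_edges (x |: A)) <= rig_span p F)%MS.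
  apply: submx_trans (rigid_extension gp xA JA dJ) _.
  by apply: rig_spanS; rewrite subUset AF star_sub.
apply/subsetP => s sA; apply: cF; last exact: submx_trans (rig_row_span p sA) H.
by apply: (subsetP (all_edgesS _)) sA; rewrite subUset sub1set xU.
Qed.

(** A nonadjacent pair [a], [b] of neighbours is not spanned, since [F] is closed; with d-1 further
    neighbours it permits a 1-extension. *)
Lemma induced_gain U F W v : F \subset all_edges U -> closed_on U F ->
  W \subset U -> v \in W ->
  (rig_rank p (F :&: all_edges (W :\ v)) +
    gain d (fun J => all_edges J \subset F) (nbrs F v :&: W)
     <= rig_rank p (F :&: all_edges W))%N.
Proof.
move=> FU cF WU vW; set J := nbrs F v :&: W; set F' := F :&: _.
have vJ : v \notin J by rewrite inE negb_and (nbrsN _ FU).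
have vF s : s \in F' -> v \notin s by rewrite inE => /andP [_ /all_edges_notin].
have F'W : F' :|: star v J \subset F :&: all_edges W.
  rewrite subUset setIS ?all_edgesS ?subD1set //= subsetI star_sub ?subsetIl //=.
  apply/subsetP => s /imsetP [z zJ ->]; apply: mem_all_edges => //.
    by move: zJ; rewrite inE => /andP [].
  by apply: contraNneq vJ => ->.
apply: leq_trans (rig_rankS p F'W); rewrite /gain.
case: (boolP ((d < #|J|)%N && _)) => [/andP [dJ nJ]|_] /=; last first.
  by rewrite addn0; apply: zero_extension_min.
rewrite (minn_idPl (ltnW dJ)) addn1.
have /subsetPn [s] := nJ; rewrite inE => /andP [sJ /cards2P [a [b [ab sE]]]] sF.
move: sJ sF; rewrite sE subUset !sub1set => /andP [aJ bJ] abF.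
have [Y YJ Yc] : exists2 Y : {set T}, Y \subset J :\ a :\ b & #|Y| = d.-1.
  apply: subset_of_card; move: dJ; rewrite (cardsD1 a) aJ (cardsD1 b (J :\ a)).
  by rewrite in_setD1 eq_sym ab bJ !add1n ltnS => dJ; rewrite -subn1 leq_subLR add1n.
have YJ' z : z \in Y -> [/\ z != a, z != b & z \in J].
  by move=> /(subsetP YJ); rewrite !in_setD1 => /and3P [-> -> ->].
have bY : b \notin Y by apply/negP => /YJ' [_]; rewrite eqxx.
have abY : a \notin b |: Y.
  by rewrite !inE negb_or ab; apply/negP => /YJ' []; rewrite eqxx.
have ZJ : a |: (b |: Y) \subset J.
  by rewrite !subUset !sub1set aJ bJ; apply/subsetP => z /YJ' [].
have Zc : #|a |: (b |: Y)| = d.+1 by rewrite !cardsU1 abY bY Yc !add1n prednK.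
apply: leq_trans (rig_rankS p (setUS F' (imsetS _ ZJ))).
apply: (@one_extension _ _ _ _ gp _ _ _ a b) => //.
- by apply: contra vJ; apply: (subsetP ZJ).
- by rewrite !inE eqxx.
- by rewrite !inE eqxx orbT.
apply: contra abF => abF'; apply: cF.
  have JU : J \subset U by apply: subset_trans (subsetIr _ _) WU.
  by apply: mem_all_edges; rewrite ?(subsetP JU).
by apply: submx_trans abF' _; rewrite rig_spanS ?subsetIl.
Qed.

Lemma nonsimplicial_rank U F : F \subset all_edges U -> closed_on U F ->
  (forall v, v \in U -> (d * d.+1 <= #|nbrs F v|)%N) ->
  (forall v, v \in U -> ~~ (all_edges (nbrs F v) \subset F)) ->
  (d * #|U| <= rig_rank p F)%N.
Proof.
move=> FU cF deg nsimp.
pose cl J := all_edges J \subset F.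
have clS J J' : J' \subset J -> cl J -> cl J'.
  by move=> JJ; apply: subset_trans; apply: all_edgesS.
have := @averaging rat T (nbrs F) (fun W => (rig_rank p (F :&: all_edges W))%:R)
  (fun v J => (gain d cl J)%:R) (fun v J => expected_gain d cl J) U U.
move=> /(_ _ _ _ _ (subxx U)) H.
have : (\sum_(v in U) expected_gain d cl (nbrs F v :&: U) <= (rig_rank p F)%:R :> rat).
  rewrite -{2}(setIidPl FU); apply: H => //.
  - by move=> v; apply: nbrsN FU.
  - move=> W v WU vW; rewrite -natrD ler_nat; exact: induced_gain FU cF WU vW.
  (* If removing [u] or [u'] leaves a clique, adding [v] gives two cliques sharing [v] and at least
     d-1 vertices of [J]. Closedness then makes [J] a clique. *)
  move=> v J vU JN; apply: expected_gain_le => // dJ nJ u u' uJ u'J clu clu'.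
  apply/eqP; apply: contraT => uu'; case/negP: nJ.
  have vJ : v \notin J by apply: contra (nbrsN v FU); apply: (subsetP JN).
  have JU : J \subset U by apply: subset_trans JN (nbrs_sub _ FU).
  have clv A : A \subset J -> cl A -> cl (v |: A).
    move=> AJ clA; apply/subsetP => s; rewrite inE => /andP [sA /cards2P [a [b [ab sE]]]].
    move: sA; rewrite sE subUset !sub1set !inE => /andP [aA bA].
    have inN z : z \in A -> [set v; z] \in F.
      by move=> /(subsetP AJ)/(subsetP JN); rewrite inE.
    case/predU1P: aA ab => [->|aA]; case/predU1P: bA => [->|bA] ab.
    - by rewrite eqxx in ab.
    - exact: inN.
    - by rewrite setUC inN.
    - by apply: (subsetP clA); apply: mem_all_edges.
  have uU : u \in U by apply: (subsetP JU).
  have uE : u |: (v |: (J :\ u)) = v |: J by rewrite setUCA setD1K.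
  apply: (@clS (v |: J)); first exact: subsetUr.
  rewrite -uE; apply: (@closed_clique_ext U F _ u (v |: (J :\ u :\ u'))) => //.
  - rewrite subUset sub1set vU; apply: subset_trans JU; exact: subD1set.
  - rewrite !inE eqxx orbF; apply: contraNneq vJ => <-.
    exact: uJ.
  - by apply: clv => //; apply: subD1set.
  - by apply: setUS; apply: subD1set.
  - have /subsetP clu'' : cl (v |: (J :\ u')) by apply: clv => //; apply: subD1set.
    have uv : u != v by apply: contraNneq vJ => <-.
    apply/subsetP => z zJ; rewrite inE; apply: clu''.
    apply: mem_all_edges; rewrite ?inE ?uu' ?uJ ?orbT //.
      by move: zJ; rewrite !inE => /predU1P [->|/and3P [-> _ ->]]; rewrite ?eqxx ?orbT.
    by move: zJ; rewrite !inE => /predU1P [->|/and3P [_ zu _]]; rewrite // eq_sym.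
  - rewrite cardsU1 !inE (negPf vJ) !andbF /=.
    move: dJ; rewrite (cardsD1 u) uJ (cardsD1 u' (J :\ u)).
    by rewrite !inE eq_sym uu' u'J !add1n ltnS.
move=> H1; rewrite -(ler_nat rat); apply: (le_trans _ H1).
rewrite mulnC natrM mulr_natl -sumr_const; apply: ler_sum => v vU.
rewrite (setIidPl (nbrs_sub _ FU)); apply: expected_gain_full => //.
  exact: nsimp.
exact: deg.
Qed.

(** Induction on [#|U|]. Without a simplicial vertex, [nonsimplicial_rank] contradicts
    [rig_rank_le]; otherwise the graph minus that vertex is complete and the vertex is attached
    back. *)
Lemma closed_connected_complete U F : F \subset all_edges U -> closed_on U F ->
  connected_on U F (d * d.+1) -> all_edges U \subset F.
Proof.
have [n] := ubnP #|U|; elim: n U F => // n IH U F Un FU cF cU.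
have dU : (d <= #|U|)%N.
  by case: cU => kU _; apply: ltnW; apply: leq_ltn_trans kU; rewrite leq_pmulr.
have [/exists_inP [v vU simp]|] :=
  boolP [exists v in U, all_edges (nbrs F v) \subset F]; last first.
  rewrite negb_exists_in => /forall_inP nsimp.
  have := nonsimplicial_rank FU cF (fun v vU => connected_on_degree FU cU vU) nsimp.
  have := rig_rank_le gp FU dU.
  have : (0 < 'C(d.+1, 2))%N by rewrite bin_gt0.
  clear; lia.
have vN := nbrsN v FU; have NU := nbrs_sub v FU.
have dN := connected_on_degree FU cU vU.
have dd : (d <= d * d.+1)%N by rewrite leq_pmulr.
(* If [v] is adjacent to all other vertices, the claim is immediate; otherwise enough vertices
   remain for the deletion to keep the connectivity. *)
have [UN|NU'] := leqP #|U| #|v |: nbrs F v|.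
  have -> : U = v |: nbrs F v.
    by apply/esym/eqP; rewrite eqEcard UN subUset sub1set vU NU.
  apply: (closed_clique_ext cF vU NU vN simp (subxx _) (subxx _)).
  exact: leq_trans dN.
have vU' : v \notin U :\ v by rewrite !inE eqxx.
have F'F : all_edges (U :\ v) \subset F :&: all_edges (U :\ v).
  apply: IH.
  - by move: Un; rewrite (cardsD1 v) vU.
  - exact: subsetIr.
  - move=> s sU sF; rewrite in_setI sU andbT; apply: cF.
      by apply: (subsetP (all_edgesS (subD1set U v))).
    by apply: submx_trans sF _; rewrite rig_spanS ?subsetIl.
  - apply: connected_on_simplicial => //.
    by apply: leq_ltn_trans NU'; rewrite cardsU1 vN.
rewrite -(setD1K vU); apply: (@closed_clique_ext U F _ _ (nbrs F v)) => //.
- exact: subD1set.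
- exact: subset_trans F'F (subsetIl _ _).
- by rewrite subsetD1 NU.
- exact: leq_trans dN.
Qed.

Lemma connected_rigid U F : F \subset all_edges U -> connected_on U F (d * d.+1) ->
  (rig_rank p F + 'C(d.+1, 2) = d * #|U|)%N.
Proof.
move=> FU cU; have dU : (d <= #|U|)%N.
  by case: cU => kU _; apply: ltnW; apply: leq_ltn_trans kU; rewrite leq_pmulr.
pose G := [set s in all_edges U | (rig_row p s <= rig_span p F)%MS].
have GF : (rig_span p G <= rig_span p F)%MS.
  by apply: rig_span_subP => s; rewrite inE => /andP [].
have FG : F \subset G.
  by apply/subsetP => s sF; rewrite inE (subsetP FU) //= rig_row_span.
have UG : all_edges U \subset G.
  apply: closed_connected_complete; last exact: connected_onS FG cU.
    by apply/subsetP => s; rewrite inE => /andP [].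
  by move=> s sU sG; rewrite inE sU (submx_trans sG).
apply/eqP; rewrite eqn_leq rig_rank_le //= -(rig_rank_all_edges gp dU) leq_add2r.
by apply: leq_trans (rig_rankS p UG) (rig_rank_span GF).
Qed.

End Rigidity.

(** * Splits of the rigidity matroid *)

Definition no_split (A : finType) (r : {set A} -> nat) (E : {set A}) (t : nat) : Prop :=
  forall E1 : {set A}, E1 \subset E -> (r E1 + r (E :\: E1) <= r E + t)%N ->
    (r E <= r E1)%N \/ (r E <= r (E :\: E1))%N.

(** If neither side spans, both ranks exceed the excess, so the bipartition is a vertical separation
    of order one more than its excess. *)
Lemma vert_connected_no_split (A : finType) (r : {set A} -> nat) (E : {set A}) k :
  (forall E1 E2, r (E1 :|: E2) <= r E1 + r E2)%N -> (1 < k)%N ->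
  vert_connected r E k -> no_split r E (k - 2).
Proof.
move=> rU k1 [_ nosep] E1 E1E le; set E2 := E :\: E1 in le *.
have E12 : E1 :|: E2 = E.
  by rewrite /E2 setDE setUIr setUCr setIT; apply/setUidPr.
have := rU E1 E2; rewrite E12 => sub.
have [?|lt1] := leqP (r E) (r E1); first by left.
have [?|lt2] := leqP (r E) (r E2); first by right.
case: (nosep (r E1 + r E2 - r E).+1 _ _) => //; first by move: le k1; clear; lia.
exists E1, E2; split=> //.
- by rewrite -setI_eq0 /E2 setIDA setDIl setDv set0I.
- by move: lt2 sub; clear; lia.
- by move: lt1 sub; clear; lia.
- by move: sub; clear; lia.
Qed.

Lemma no_split_imset (A B : finType) (r : {set A} -> nat) (r' : {set B} -> nat)
    (psi : A -> B) (E : {set A}) t : {in E &, injective psi} ->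
  (forall X : {set A}, X \subset E -> r' (psi @: X) = r X) ->
  no_split r E t -> no_split r' (psi @: E) t.
Proof.
move=> inj rr nsp Y1 Y1E.
pose E1 := [set x in E | psi x \in Y1].
have E1E : E1 \subset E by apply/subsetP => x; rewrite inE => /andP [].
have Y1E1 : psi @: E1 = Y1.
  apply/setP => y; apply/imsetP/idP => [[x]|yY].
    by rewrite inE => /andP [_ ?] ->.
  have /imsetP [x xE yx] := subsetP Y1E y yY.
  by exists x => //; rewrite inE xE -yx.
have D1 : psi @: (E :\: E1) = psi @: E :\: Y1.
  apply/setP => y; apply/imsetP/idP => [[x]|].
    by rewrite !inE negb_and => /andP [+ xE] ->; rewrite xE imset_f // andbT.
  rewrite inE => /andP [yY /imsetP [x xE yx]]; exists x => //.
  by rewrite !inE xE -yx (negPf yY).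
by rewrite -D1 -{1 2}Y1E1 !rr ?subsetDl //; apply: nsp.
Qed.

Section Splits.
Variables (R : realType) (d : nat) (T : finType) (p : T -> 'rV[R]_d).
Hypotheses (gp : generic p) (d0 : (0 < d)%N).
Implicit Types (E F : {set {set T}}) (U S : {set T}).

(** With no lower bound on [#|U|], this turns a large rank into a lower bound on the number of
    vertices. *)
Lemma rig_rank_le_max U F : F \subset all_edges U ->
  (rig_rank p F + 'C(d.+1, 2) <= d * maxn d #|U|)%N.
Proof.
move=> FU; case: (leqP d #|U|) => dU; first exact: rig_rank_le.
rewrite -binS2_sq leq_add2r; apply: leq_trans (rig_rank_card _ _) _.
apply: leq_trans (subset_leq_card FU) _.
rewrite (_ : #|_| = 'C(#|U|, 2)); first by rewrite leq_bin2l // ltnW.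
by rewrite -cards_draws; apply: eq_card => s; rewrite !inE.
Qed.

Lemma at_rig_row_neq0 (s : {set T}) u : #|s| == 2 -> u \in s ->
  at_vertex u (rig_row p s) != 0.
Proof.
move=> /cards2P [x [y [xy ->]]] us.
wlog -> : x y xy us / u = x.
  move=> H; move: (us); rewrite !inE => /orP [] /eqP uE; first exact: H.
  by rewrite setUC; apply: H => //; rewrite 1?eq_sym // setUC.
rewrite at_rig_rowl //; apply/eqP => pxy.
pose c z : R := if z == x then 1 else -1.
have : c x = 0; last by rewrite /c eqxx => /eqP; rewrite oner_eq0.
apply: (generic_affine_indep (c := c) gp (Z := [set x; y])); rewrite ?set21 //.
- by rewrite cards2 xy !ltnS.
- rewrite big_setU1 ?big_set1 ?inE //= /c eqxx eq_sym (negPf xy).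
  by rewrite scale1r scaleN1r.
- by rewrite big_setU1 ?big_set1 ?inE //= /c eqxx eq_sym (negPf xy) subrr.
Qed.

(** If no edge of [E] met [u], its span would vanish there, but the row of [s] does not. *)
Lemma spanning_cover F E (s : {set T}) u : E \subset F ->
  (rig_rank p F <= rig_rank p E)%N -> s \in F -> #|s| == 2 -> u \in s -> exists2 s', s' \in E & u \in s'.
Proof.
move=> EF rE sF s2 us; apply/exists_inP; apply: contraT.
rewrite negb_exists_in => /forall_inP uE.
have := at_rig_row_neq0 s2 us; rewrite (@at_span_out _ _ _ p E) ?eqxx //.
exact: submx_trans (rig_row_span p sF) (rig_span_rank EF rE).
Qed.

(** Both graphs are rigid, so [F] loses exactly [d], while the two sides together lose at least d+1,
    as [w] meets both and has large degree. For the second claim: if [w] has fewer than [d] edges in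
    [E1], its star in [E2] has so large a rank that the excess passes [t]. *)
Lemma split_step U F E1 E2 t w : F \subset all_edges U ->
  connected_on U F (d * d.+1 + t.+1) -> E1 :|: E2 = F -> w \in U ->
  (0 < #|nbrs E1 w|)%N -> (0 < #|nbrs E2 w|)%N ->
  (rig_rank p E1 + rig_rank p E2 <= rig_rank p F + t)%N ->
  let del E := E :&: all_edges (U :\ w) in
  (rig_rank p (del E1) + rig_rank p (del E2) < rig_rank p (del F) + t)%N /\
  ((rig_rank p (del F) <= rig_rank p (del E1))%N -> (rig_rank p F <= rig_rank p E1)%N).
Proof.
move=> FU cU EF wU n1 n2 le del.
have E1F : E1 \subset F by rewrite -EF subsetUl.
have E2F : E2 \subset F by rewrite -EF subsetUr.
have rF := connected_rigid gp d0 FU (connected_onW (leq_addr _ _) cU).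
have cU' : connected_on (U :\ w) (del F) (d * d.+1 + t).
  by apply: connected_on_del => //; rewrite -addnS.
have rF' := connected_rigid gp d0 (subsetIr _ _) (connected_onW (leq_addr _ _) cU').
have deg := connected_on_degree FU cU wU.
have degU : (#|nbrs F w| <= #|nbrs E1 w| + #|nbrs E2 w|)%N.
  apply: leq_trans (leq_card_setU _ _); apply: subset_leq_card; apply/subsetP => z.
  by rewrite !inE -EF inE.
have nE E : E \subset F -> w \notin nbrs E w.
  by move=> EF'; apply: (@nbrsN _ U); apply: subset_trans FU.
have drop E : E \subset F ->
    (rig_rank p (del E) + minn d #|nbrs E w| <= rig_rank p E)%N.
  move=> EF'; apply: leq_trans (zero_extension_min gp _ (nE E EF')) _.
    by move=> s; rewrite inE => /andP [_ /all_edges_notin].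
  by apply: rig_rankS; rewrite subUset subsetIl star_sub.
have st E : E \subset F -> (#|nbrs E w| <= rig_rank p E)%N.
  move=> EF'; apply: leq_trans (star_rank gp d0 (nE E EF')) _.
  by apply: rig_rankS; rewrite star_sub.
have dd : (d <= d * d.+1)%N by rewrite leq_pmulr.
have Uc := cardsD1 w U; rewrite wU add1n in Uc.
rewrite Uc mulnS in rF.
have {st} := st E2 E2F; have := drop E1 E1F; have := drop E2 E2F.
rewrite -/(del F) in rF' *.
move: (rig_rank p (del E1)) (rig_rank p (del E2)) (rig_rank p (del F)) rF'
  (rig_rank p E1) (rig_rank p E2) (rig_rank p F) rF le degU deg n1 n2.
move=> e1' e2' f' rF' e1 e2 f.
move: #|nbrs E1 w| #|nbrs E2 w| #|nbrs F w| (d * d.+1)%N dd => n1 n2 n k.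
move: (d * _)%N rF' => D; move: 'C(_, _) => C.
by move: d0; clear; move=> h0 rF' dd rF le degU deg h1 h2 H1 H2 H3; split; lia.
Qed.

(** Both sides are nonempty; without a mixed vertex, the vertices met by [E1] would form a closed
    set missing those of [E2]. *)
Lemma mixed_vertex U F E1 E2 : F \subset all_edges U -> connected_on U F 1 ->
  E1 :|: E2 = F ->
  (rig_rank p E1 < rig_rank p F)%N -> (rig_rank p E2 < rig_rank p F)%N ->
  exists2 w, w \in U & (0 < #|nbrs E1 w|)%N && (0 < #|nbrs E2 w|)%N.
Proof.
move=> FU cU EF lt1 lt2.
have E1F : E1 \subset F by rewrite -EF subsetUl.
have E2F : E2 \subset F by rewrite -EF subsetUr.
have edge E : E \subset F -> E != set0 -> exists x y, [set x; y] \in E.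
  move=> EF' /set0Pn [s sE]; have := subsetP FU _ (subsetP EF' _ sE).
  by rewrite inE => /andP [_ /cards2P [x [y [_ e]]]]; exists x, y; rewrite -e.
have [x [y xy]] : exists x y, [set x; y] \in E1.
  by apply: edge => //; apply: contraTneq lt2 => E0; rewrite -EF E0 set0U ltnn.
have [x' [y' xy']] : exists x y, [set x; y] \in E2.
  by apply: edge => //; apply: contraTneq lt1 => E0; rewrite -EF E0 setU0 ltnn.
have nb E a b : [set a; b] \in E -> (0 < #|nbrs E a|)%N.
  by move=> abE; apply/card_gt0P; exists b; rewrite inE.
apply/exists_inP; apply: contraT; rewrite negb_exists_in => /forall_inP nomix.
pose X := [set z | (0 < #|nbrs E1 z|)%N].
have x'X : x' \in X.
  apply: (connected_on_closed (S := set0) (u := x) cU); rewrite ?cards0 ?inE //.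
  - move=> a b abF _ _; rewrite !inE => aX.
    move: (abF); rewrite -EF inE => /orP [abE|abE].
      by apply: (nb E1 b a); rewrite setUC.
    by have [aU _] := edge_in FU abF; have := nomix a aU; rewrite aX (nb E2 a b).
  - by case: (edge_in FU (subsetP E1F _ xy)).
  - exact: nb xy.
  - by case: (edge_in FU (subsetP E2F _ xy')).
have [x'U _] := edge_in FU (subsetP E2F _ xy').
by have := nomix x' x'U; move: x'X; rewrite inE => ->; rewrite (nb E2 x' y').
Qed.

Lemma connected_split U F E1 E2 t : F \subset all_edges U ->
  connected_on U F (d * d.+1 + t.+1) -> E1 :|: E2 = F ->
  (rig_rank p E1 + rig_rank p E2 <= rig_rank p F + t)%N ->
  (rig_rank p F <= rig_rank p E1)%N \/ (rig_rank p F <= rig_rank p E2)%N.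
Proof.
elim: t U F E1 E2 => [|t IH] U F E1 E2 FU cU EF le.
all: have [?|lt1] := leqP (rig_rank p F) (rig_rank p E1); first by left.
all: have [?|lt2] := leqP (rig_rank p F) (rig_rank p E2); first by right.
all: have c1 : connected_on U F 1 by apply: connected_onW cU; rewrite addnS.
all: have [w wU /andP [n1 n2]] := mixed_vertex FU c1 EF lt1 lt2.
all: have [lt s1] := split_step FU cU EF wU n1 n2 le.
all: have EF' : E2 :|: E1 = F by rewrite setUC.
all: have le' := le; rewrite addnC in le'.
all: have [_ s2] := split_step FU cU EF' wU n2 n1 le'.
all: set W := all_edges (U :\ w) in lt s1 s2.
all: have EW : (E1 :&: W) :|: (E2 :&: W) = F :&: W by rewrite -setIUl EF.
  (* For [t = 0] the excess after deletion would be negative, against subadditivity. *)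
  by move: lt; rewrite addn0 ltnNge -EW rig_rankU.
have [||||/s1|/s2] := IH (U :\ w) (F :&: W) (E1 :&: W) (E2 :&: W) => //.
- exact: subsetIr.
- by apply: connected_on_del => //; rewrite -addnS.
- by move: lt; rewrite addnS ltnS.
- by rewrite leqNgt lt1.
- by rewrite leqNgt lt2.
Qed.

Lemma connected_no_split U F t : F \subset all_edges U ->
  connected_on U F (d * d.+1 + t.+1) -> no_split (rig_rank p) F t.
Proof.
move=> FU cU E1 E1F; apply: connected_split FU cU _.
by rewrite setDE setUIr setUCr setIT; apply/setUidPr.
Qed.

(** If [S] separates [u] from [v], the edges meeting the component of [u] and the remaining edges
    have excess at most [d * (#|S| - 1)]. One side would then span, but the first misses [v] and the
    second misses [u]. *)
Lemma no_split_connected U F k t : F \subset all_edges U ->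
  (forall u, u \in U -> exists2 s, s \in F & u \in s) ->
  no_split (rig_rank p) F t -> (d * (k - 2) <= t)%N -> (k < #|U|)%N ->
  connected_on U F k.
Proof.
move=> FU iso nsp kt kU; split=> // S Sk u v uU vU uS vS.
apply: contraT => nuv; set e := [rel _ _ | _] in nuv.
have F2 s : s \in F -> #|s| == 2.
  by move=> /(subsetP FU); rewrite inE => /andP [].
pose A := [set z | connect e u z].
have AS a : a \in A -> a \notin S.
  rewrite inE => /connectP [q]; elim/last_ind: q => [_ ->|q z _] //.
  by rewrite rcons_path last_rcons => /andP [_ /and3P [_ _ zS]] ->.
have Aclosed s a z : s \in F -> a \in s -> z \in s -> a \in A -> z \notin S -> z \in A.
  move=> sF as_ zs aA zS; have [-> //|az] := eqVneq z a.
  have sE : s = [set a; z].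
    apply/esym/eqP; rewrite eqEcard subUset !sub1set as_ zs /=.
    by rewrite (eqP (F2 s sF)) cards2 eq_sym az.
  have aS := AS a aA; move: aA; rewrite !inE => ua; apply: connect_trans ua (connect1 _).
  by rewrite /= -sE sF aS.
pose E1 := [set s in F | [exists a in A, a \in s]].
have E1F : E1 \subset F by apply/subsetP => s; rewrite inE => /andP [].
have E12 : E1 :|: (F :\: E1) = F.
  by rewrite setDE setUIr setUCr setIT; apply/setUidPr.
have sep : (rig_rank p E1 + rig_rank p (F :\: E1) <= rig_rank p F + t)%N.
  rewrite -{2}E12; apply: leq_trans (@separation_rank _ _ _ p S E1 (F :\: E1) _ _) _.
  - by move=> s /(subsetP E1F) /F2.
  - move=> s1 s2; rewrite !inE => /andP [s1F /exists_inP [a aA as1]].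
    move=> /andP [+ s2F]; rewrite s2F /= negb_exists_in => /forall_inP s2A.
    apply/subsetP => z; rewrite inE => /andP [zs1 zs2]; apply: contraT => zS.
    by have := s2A z (Aclosed s1 a z s1F as1 zs1 aA zS); rewrite zs2.
  rewrite leq_add2l; apply: leq_trans kt; rewrite leq_mul2l; apply/orP; right.
  by move: Sk; clear; lia.
have uA : u \in A by rewrite inE connect0.
have [r1|r2] := nsp E1 E1F sep.
  have [s sF vs] := iso v vU.
  have [s' + vs'] := spanning_cover E1F r1 sF (F2 s sF) vs.
  rewrite inE => /andP [s'F /exists_inP [a aA as']].
  by have := Aclosed s' a v s'F as' vs' aA vS; rewrite inE (negPf nuv).
have [s sF us] := iso u uU.
have [s' + us'] := spanning_cover (subsetDl F E1) r2 sF (F2 s sF) us.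
rewrite !inE => /andP [+ s'F]; rewrite s'F /= => /negP [].
by apply/exists_inP; exists u.
Qed.

End Splits.

(** * Reconstruction *)

Lemma mem_edges (T : finType) (e : rel T) x y : ssrbool.symmetric e ->
  ([set x; y] \in edges e) = e x y.
Proof.
move=> sym; apply/imsetP/idP => [[[a b] /= ab eq]|xy]; last by exists (x, y).
rewrite inE /= in ab.
have : x \in [set a; b] by rewrite -eq set21.
have : y \in [set a; b] by rewrite -eq set22.
have : a \in [set x; y] by rewrite eq set21.
have : b \in [set x; y] by rewrite eq set22.
rewrite !inE => bxy axy /orP [] /eqP ye /orP [] /eqP xe; move: axy bxy ab; subst x y.
- by rewrite !orbb => _ /eqP ->.
- by rewrite sym.
- by [].
- by rewrite !orbb => /eqP ->.
Qed.

Lemma edges_all (T : finType) (e : rel T) : irreflexive e ->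
  edges e \subset all_edges [set: T].
Proof.
move=> irr; apply/subsetP => s /imsetP [[a b] /= ab ->].
apply: mem_all_edges; rewrite ?inE //; apply: contraTneq ab => /= ->.
by rewrite inE /= irr.
Qed.

Lemma k_connected_connected_on (T : finType) (e : rel T) k : ssrbool.symmetric e ->
  k_connected e k -> connected_on [set: T] (edges e) k.
Proof.
move=> sym [kT ck]; split; first by rewrite cardsT.
move=> S Sk u v _ _ uS vS.
have <- := eq_connect (e := [rel x y | [&& e x y, x \notin S & y \notin S]]).
  exact: ck.
by move=> x y /=; rewrite mem_edges.
Qed.

Section Transfer.
Variables (R : realType) (d : nat) (T T' : finType).
Variables (p : T -> 'rV[R]_d) (q : T' -> 'rV[R]_d).
Hypotheses (gp : generic p) (gq : generic q) (d0 : (0 < d)%N).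
Variable psi : {set T} -> {set T'}.
Implicit Types (X F : {set {set T}}) (U : {set T}).

(** The excess bound is [d * (k - 2)] for [k = d * d.+1], as [no_split_connected] requires to make
    the image [k]-connected, hence rigid. Equal ranks then force equal vertex numbers. *)
Lemma iso_rigid U X : X \subset all_edges U ->
  connected_on U X (d * d.+1 + (d * (d * d.+1 - 2)).+1) ->
  {in X &, injective psi} ->
  (forall F, F \subset X -> rig_rank q (psi @: F) = rig_rank p F) ->
  psi @: X \subset all_edges [set: T'] ->
  #|cover (psi @: X)| = #|U| /\
  (rig_rank q (psi @: X) + 'C(d.+1, 2) = d * #|cover (psi @: X)|)%N.
Proof.
move=> XU cU inj rk; set Y := psi @: X; set U' := cover Y => Y2.
have YU : Y \subset all_edges U'.
  apply/subsetP => s sY; have := subsetP Y2 s sY; rewrite !inE => /andP [_ ->].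
  by rewrite andbT; apply: bigcup_sup.
have rX := connected_rigid gp d0 XU (connected_onW (leq_addr _ _) cU).
have rY : rig_rank q Y = rig_rank p X by apply: rk.
have kU : (d * d.+1 < #|U|)%N.
  by case: cU => kU _; apply: leq_ltn_trans kU; apply: leq_addr.
have dd : (d <= d * d.+1)%N by rewrite leq_pmulr.
have UU : (#|U| <= #|U'|)%N.
  have := rig_rank_le_max gq YU; rewrite rY rX leq_pmul2l //.
  by move: kU dd; clear; lia.
have cU' : connected_on U' Y (d * d.+1).
  apply: (no_split_connected gq d0 (t := d * (d * d.+1 - 2))) => //.
  - by move=> u /bigcupP [s sY us]; exists s.
  - apply: (no_split_imset inj rk); exact: (connected_no_split gp d0 XU cU).
  - exact: leq_trans UU.
have rY' := connected_rigid gq d0 YU cU'; split=> //.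
by move: rY'; rewrite rY rX => /eqP; rewrite eqn_pmul2l // => /eqP.
Qed.

End Transfer.

Section Reconstruction.
Variables (R : realType) (d : nat) (T T' : finType) (e : rel T) (e' : rel T').
Variables (p : T -> 'rV[R]_d) (q : T' -> 'rV[R]_d).
Hypotheses (gp : generic p) (gq : generic q) (d0 : (0 < d)%N).
Variable psi : {set T} -> {set T'}.
Hypotheses (ge : is_graph e) (ge' : is_graph e').
(** One more than [iso_rigid] asks for, so that it applies after deleting a vertex too. *)
Hypothesis conn :
  connected_on [set: T] (edges e) (d * d.+1 + (d * (d * d.+1 - 2)).+2).
Hypothesis inj : {in edges e &, injective psi}.
Hypothesis im : psi @: edges e = edges e'.
Hypothesis rk :
  forall F : {set {set T}}, F \subset edges e -> rig_rank q (psi @: F) = rig_rank p F.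

Let E_all : edges e \subset all_edges [set: T].
Proof. by case: ge => _ irr _; apply: edges_all. Qed.

Let im_all (X : {set {set T}}) :
  X \subset edges e -> psi @: X \subset all_edges [set: T'].
Proof.
move=> XE; apply: subset_trans (imsetS _ XE) _; rewrite im.
by case: ge' => _ irr _; apply: edges_all.
Qed.

Let card_T' : #|T'| = #|T|.
Proof.
have [|||||cU _] := @iso_rigid R d T T' p q gp gq d0 psi [set: T] (edges e) => //.
- by apply: connected_onW conn; rewrite leq_add2l.
- exact: im_all.
suff /setP cE : cover (psi @: edges e) = [set: T'].
  by rewrite -!cardsT -cU; apply: eq_card.
apply/setP => v; rewrite inE im; case: ge' => sym _ /(_ v) [u vu].
by apply/bigcupP; exists [set v; u]; rewrite ?set21 // mem_edges.
Qed.

Let del v := edges e :&: all_edges ([set: T] :\ v).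

Let delE v : del v \subset edges e. Proof. exact: subsetIl. Qed.

Let rigid_del v : #|cover (psi @: del v)|.+1 = #|T'| /\
  (rig_rank q (psi @: del v) + 'C(d.+1, 2) = d * #|cover (psi @: del v)|)%N.
Proof.
have [|||||cU ?] := @iso_rigid R d T T' p q gp gq d0 psi ([set: T] :\ v) (del v).
- exact: subsetIr.
- by apply: connected_on_del; rewrite ?inE // -addnS.
- by move=> x y /(subsetP (delE v)) xE /(subsetP (delE v)) yE; apply: inj.
- by move=> F FX; apply: rk; apply: subset_trans FX (delE v).
- exact: im_all.
split=> //; rewrite cU card_T' -[in RHS]cardsT.
by rewrite (cardsD1 v [set: T]) inE.
Qed.

Let missing_ex v : exists w, w \notin cover (psi @: del v).
Proof.
apply/existsP; apply: contraT; rewrite negb_exists => /forallP all_in.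
have [H _] := rigid_del v; move: H.
suff -> : #|cover (psi @: del v)| = #|T'| by move=> /eqP; rewrite eqn_leq ltnn.
rewrite -cardsT; apply: eq_card => w; rewrite !inE.
by have := all_in w; rewrite negbK.
Qed.

Let phi v : T' := xchoose (missing_ex v).

Let phi_missing v w : (w \in cover (psi @: del v)) = (w != phi v).
Proof.
have pv : phi v \notin cover (psi @: del v) := xchooseP (missing_ex v).
have : cover (psi @: del v) == [set~ phi v].
  rewrite eqEcard cardsC1; have [<- _] := rigid_del v; rewrite leqnn andbT.
  by apply/subsetP => x xU; rewrite !inE; apply: contraNneq pv => <-.
by move=> /eqP ->; rewrite !inE.
Qed.

(** If [f] contains [v] but [psi f] avoids [phi v], then [psi f] lies on the vertices of the rigid
    image of [del v] and adds no rank, whereas [f] adds rank to [del v]. *)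
Let phi_incident v f : f \in edges e -> (phi v \in psi f) = (v \in f).
Proof.
move=> fE; apply/idP/idP => [|vf].
  apply: contraTT => vf; have fD : f \in del v.
    have := subsetP E_all f fE; rewrite !inE fE => /andP [_ ->] /=.
    by rewrite andbT subsetD1 subsetT.
  apply/negP => pvf; have := phi_missing v (phi v); rewrite eqxx => /negP [].
  by apply/bigcupP; exists (psi f) => //; apply: imset_f.
apply: contraT => pf; have fD : f |: del v \subset edges e.
  by rewrite subUset sub1set fE delE.
have [cd rd] := rigid_del v; set U' := cover _ in cd rd.
have fDU : psi @: (f |: del v) \subset all_edges U'.
  apply/subsetP => s sP; have := subsetP (im_all fD) s sP.
  rewrite !inE => /andP [_ ->]; rewrite andbT; move: sP.
  rewrite imsetU1 => /setU1P [->|sD]; last exact: bigcup_sup.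
  by apply/subsetP => w wf; rewrite phi_missing; apply: contraNneq pf => <-.
have : (rig_rank q (psi @: (f |: del v)) <= rig_rank q (psi @: del v))%N.
  rewrite -(leq_add2r 'C(d.+1, 2)) rd; apply: rig_rank_le => //.
  have : (d * d.+1 < #|T|)%N.
    by case: conn => kT _; rewrite -cardsT; apply: leq_ltn_trans kT; apply: leq_addr.
  have : (d <= d * d.+1)%N by rewrite leq_pmulr.
  by rewrite -card_T' -cd; clear; lia.
rewrite !rk // leqNgt => /negP; case; apply: rig_rankU1; apply/negP => fs.
have f2 : #|f| == 2 by have := subsetP E_all f fE; rewrite inE => /andP [].
have := at_rig_row_neq0 gp d0 f2 vf; rewrite (@at_span_out _ _ _ p (del v)) ?eqxx //.
by move=> s; rewrite inE => /andP [_ /all_edges_notin].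
Qed.

(** By its degree, [u] has a neighbour [z] other than [v], and the edge [uz] tells [u] and [v]
    apart. *)
Let phi_inj : injective phi.
Proof.
move=> u v puv; apply/eqP; apply: contraT => uv.
have [z /[!inE] /andP [zv uz]] : exists z, z \in nbrs (edges e) u :\ v.
  apply/card_gt0P; have := connected_on_degree E_all conn (in_setT u).
  rewrite (cardsD1 v (nbrs _ _)); have := leq_b1 (v \in nbrs (edges e) u).
  by move: (d * d.+1)%N => a; move: (d * _)%N => b; clear; lia.
have := phi_incident v uz; rewrite -puv phi_incident // set21 !inE.
by rewrite eq_sym (negPf uv) eq_sym (negPf zv).
Qed.

Lemma graph_iso : exists phi : T -> T',
  [/\ bijective phi, forall u v : T, e' (phi u) (phi v) = e u v &
      forall u v : T, e u v -> psi [set u; v] = [set phi u; phi v]].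
Proof.
have [sym irr _] := ge; have [sym' irr' _] := ge'.
have psiE u v : e u v -> psi [set u; v] = [set phi u; phi v].
  move=> uv; have uvE : [set u; v] \in edges e by rewrite mem_edges.
  have : psi [set u; v] \in all_edges [set: T'].
    by apply: (subsetP (im_all (subxx _))); apply: imset_f.
  rewrite inE => /andP [_ /eqP c2]; apply/esym/eqP; rewrite eqEcard c2 cards2.
  have nuv : u != v by apply: contraTneq uv => ->; rewrite irr.
  by rewrite (inj_eq phi_inj) nuv subUset !sub1set !phi_incident // set21 set22.
exists phi; split=> //; first by apply: inj_card_bij => //; rewrite card_T'.
move=> u v; apply/idP/idP => [|uv]; last first.
  by rewrite -(mem_edges _ _ sym') -psiE // -im; apply: imset_f; rewrite mem_edges.
move=> uv'; have : [set phi u; phi v] \in edges e' by rewrite mem_edges.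
rewrite -im => /imsetP [f fE eqf].
have uf : u \in f by rewrite -(phi_incident _ fE) -eqf set21.
have vf : v \in f by rewrite -(phi_incident _ fE) -eqf set22.
have nuv : u != v by apply: contraTneq uv' => ->; rewrite irr'.
rewrite -(mem_edges _ _ sym); suff -> : [set u; v] = f by [].
have : #|f| == 2 by have := subsetP E_all f fE; rewrite inE => /andP [].
by move=> /eqP c2; apply/eqP; rewrite eqEcard subUset !sub1set uf vf c2 cards2 nuv.
Qed.

End Reconstruction.

(** With [k = d * d.+1] and [K] the connectivity claimed, [d * (K - 2)] equals [k ^ 2 - 2 * d ^ 2],
    which is at most the excess bound [k ^ 2 - 2]. *)
Lemma vert_connected_connected (R : realType) d (T : finType) (e : rel T)
    (p : T -> 'rV[R]_d) : (0 < d)%N -> is_graph e -> generic p ->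
  vert_connected (rig_rank p) (edges e) ((d * (d + 1)) ^ 2) ->
  connected_on [set: T] (edges e) (d * d.+1 + (d * (d * d.+1 - 2)).+2).
Proof.
move=> d0 [sym irr iso] gp vc; have [rE _] := vc.
rewrite addn1 in vc rE.
have k2 : (2 <= d * d.+1)%N by move: d0; clear; nia.
apply: (no_split_connected gp d0 (t := (d * d.+1) ^ 2 - 2)).
- exact: edges_all.
- move=> u _; have [v uv] := iso u; exists [set u; v]; rewrite ?set21 //.
  by rewrite mem_edges.
- apply: vert_connected_no_split => //; first exact: rig_rankU.
  by move: k2; clear; nia.
- by move: d0 k2; clear; nia.
(* The rank is at least [k ^ 2], which forces more than [K] vertices. *)
have := rig_rank_le_max gp (edges_all irr).
have C0 : (0 < 'C(d.+1, 2))%N by rewrite bin_gt0.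
by move: d0 k2 C0 rE; clear; nia.
Qed.

Theorem theorem3p11 (R : realType) (d : nat) (T : finType) (e : rel T) :
  (0 < d)%N -> is_graph e ->
  k_connected e (d * (d + 1) ^ 2) \/ Rd_vert_connected R d e ((d * (d + 1)) ^ 2) ->
  Rd_reconstructible R d e.
Proof.
move=> d0 ge conn T' e' ge' psi [inj im rk].
have [p gp] := exists_generic R d T; have [q gq] := exists_generic R d T'.
have c : connected_on [set: T] (edges e) (d * d.+1 + (d * (d * d.+1 - 2)).+2).
  case: conn => [kc|vc]; last by apply: vert_connected_connected gp (vc p gp).
  have [sym _ _] := ge; apply: connected_onW (k_connected_connected_on sym kc).
  (* The required connectivity is d(d+1)^2 - 2(d-1), with equality to the assumed one for d = 1. *)
  by move: d0; clear; nia.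
exact: (graph_iso gp gq d0 ge ge' c inj im (fun F => rk p q gp gq F)).
Qed.
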